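(* Let $\tau$ be a random time with Azéma supermartingale $Z_t=\mathbb{Q}[t<\tau\mid\mathcal{F}_t]$ and canonical decomposition $Z=M-A$, where $A_\infty=1$ and $A_t<1$ for $t\in\mathbb{R}_+$. Suppose that the i$M$ family associated with $(\mathbb{Q},\mathbb{F},\tau)$ is differentiable on $[0,T)$ with respect to $A$, and let $\mathsf{p}_{+}$ be the regularized density function. Let $b\in[0,T)$. Then for any non-negative $\check{\mathcal{G}}^0_b$-measurable function $f$ on $\Omega\times[0,\infty]$ and any $t\in[0,b]$, $\mathbb{Q}$-almost surely, $$\mathbb{E}[f(\phi)\mid\mathcal{G}_t]=\frac{\mathbb{E}[f(\phi)\mathbf{1}_{\{t<\tau\}}\mid\mathcal{F}_t]}{Z_t}\mathbf{1}_{\{t<\tau\}}+\frac{{}^o(f\mathsf{p}_{b+})_t(\tau)}{\mathsf{p}_{t+}(\tau)}\mathbf{1}_{\{\mathsf{p}_{t+}(\tau)>0\}}\mathbf{1}_{\{\tau\le t\}}.$$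
   Context: Setting. $(\Omega,\mathcal{A},\mathbb{Q})$ is a probability space with a right-continuous filtration $\mathbb{F}=(\mathcal{F}_t)_{t\in\mathbb{R}_+}$, $\mathcal{F}_\infty=\bigvee_t\mathcal{F}_t\subset\mathcal{A}$, each $\mathcal{F}_t$ containing the $(\mathbb{Q},\mathcal{F}_\infty)$-null sets; $\tau$ is a random variable with values in $[0,\infty]$ (a random time); $T\in[0,\infty]$. For $a,b\in[0,\infty]$, $a\nmid b=a$ if $a\le b$ and $a\nmid b=\infty$ if $a>b$. $\mathcal{G}^0_t=\bigcap_{s>t}(\mathcal{F}_s\vee\sigma(\tau\nmid s))$ and $\mathcal{G}_t$ is $\mathcal{G}^0_t$ completed with the $(\mathbb{Q},\mathcal{F}_\infty\vee\sigma(\tau))$-null sets. In $Z=M-A$, $M$ is a $(\mathbb{Q},\mathbb{F})$-local martingale and $A$ is a non-negative non-decreasing $\mathbb{F}$-predictable process, extended to $[0,\infty]$ by $A_\infty=1$. Product space. On $\Omega\times[0,\infty]$ put $\pi(\omega,u)=\omega$, $\hat\tau(\omega,u)=u$, $\phi(\omega)=(\omega,\tau(\omega))$ (a map $\Omega\to\Omega\times[0,\infty]$), $\check{\mathbb{Q}}=\mathbb{Q}\circ\phi^{-1}$, $\check{\mathcal{F}}_t=\pi^{-1}(\mathcal{F}_t)$, $\check{\mathcal{G}}^0_t=\bigcap_{s>t}(\check{\mathcal{F}}_s\vee\sigma(\hat\tau\nmid s))$. i$M$ family and differentiability. The i$M$ family associated with $(\mathbb{Q},\mathbb{F},\tau)$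 is the family $(M^u:u\in[0,\infty])$ of $[0,1]$-valued càdlàg martingales with $M^u_t=\mathbb{Q}[\tau\le u\mid\mathcal{F}_t]$, right-continuous and non-decreasing in $u$. It is differentiable on $[0,T)$ with respect to $A$ if for every $t\in[0,T)$ there is a non-negative $\mathcal{F}_t\otimes\mathcal{B}[0,\infty]$-measurable $\mathsf{p}_t(\omega,v)$ such that a.s. $M^u_t=\int_{[0,u]}\mathsf{p}_t(v)\,dA_v$ for all $u\in[0,t]$ (integrals over $[0,u]$ include the mass $A_0$ at $0$). Cox measure. $\check{\mathbb{Q}}^0$ is the probability on $\mathcal{F}_\infty\otimes\mathcal{B}[0,\infty]$ with $\check{\mathbb{E}}^0[h]=\mathbb{E}[\int_{[0,\infty]}h(\cdot,v)\,dA_v]$ (mass $1-A_{\infty-}$ at $\infty$). Regularized density. $\mathsf{p}_{+}=(\mathsf{p}_{t+}(\omega,u))_{t\in[0,T)}$ is a function (which exists when the i$M$ family associated with $(\mathbb{Q},\mathbb{F},\tau)$ is differentiable on $[0,T)$ with respect to $A$) that is $\check{\mathbb{G}}^0$-adapted with all paths $t\mapsto\mathsf{p}_{t+}(\omega,u)$ càdlàg on $[0,T)$, such that $\mathsf{P}_t(\omega,u)=\mathbf{1}_{\{t<u\}}\frac{Z_t(\omega)}{1-A_t(\omega)}+\mathbf{1}_{\{u\le t\}}\mathsf{p}_{t+}(\omega,u)$ is the density of $\check{\mathbb{Q}}$ with respect to $\check{\mathbb{Q}}^0$ on $\check{\mathcal{G}}^0_t$ for $t\in[0,T)$, and $M^a_t=\int_{[0,a]}\mathsf{p}_{t+}(v)\,dA_v$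 for all $0\le a\le t<T$, $\mathbb{Q}$-a.s. Here $g(\tau)$ denotes $\omega\mapsto g(\omega,\tau(\omega))$ and $g(v)$ denotes $\omega\mapsto g(\omega,v)$. Parametrized optional projection. For a bounded or non-negative $\mathcal{F}_\infty\otimes\mathcal{B}[0,\infty]$-measurable $F$, ${}^oF=({}^oF)_t(\omega,u)$ denotes any $\mathcal{O}(\mathbb{F})\otimes\mathcal{B}[0,\infty]$-measurable function (such functions exist) satisfying: (i) $t\mapsto({}^oF)_t(t)$ is $\mathbb{F}$-optional; (ii) for every $u\in[0,\infty]$, $({}^oF)_\cdot(u)$ is a version of the $(\mathbb{Q},\mathbb{F})$-optional projection of $F(u)$ (viewed as constant in time); (iii) for every $\mathbb{F}$-stopping time $U$, $\mathbf{1}_{\{U\le t\}}({}^oF)_t(U)$, $t\in\mathbb{R}_+$, is $\mathbb{F}$-optional, and for $\mathbb{F}$-stopping times $U\le S$ and $B\in\mathcal{F}_S$ with $B\subset\{S<\infty\}$, $\mathbb{E}[\mathbf{1}_BF(U)]=\mathbb{E}[\mathbf{1}_B({}^oF)_S(U)]$. *)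

(* Defs.v *)
From HB Require Import structures.
From mathcomp Require Import all_boot all_order all_algebra.
From mathcomp Require Import all_classical all_reals all_analysis.
From mathcomp Require Import measurable_realfun.

Set Implicit Arguments.
Unset Strict Implicit.
Unset Printing Implicit Defensive.

Import Order.TTheory GRing.Theory Num.Theory.
Import numFieldTopology.Exports numFieldNormedType.Exports.

Local Open Scope classical_set_scope.
Local Open Scope ring_scope.

(* Conventions.  Sub-sigma-algebras are sets of sets, a sigma-algebra on a
   subset D of X being a set of subsets of D.  The time axis [0, oo[ is the
   non-negative part of R, and [0, oo] is the non-negative part of \bar R:
   values of processes at negative times, and of functions on Om * \bar R at
   points with a negative second coordinate, play no role.  The time argument
   of a process comes first: X t w is X_t(w). *)

(* A function on D that is measurable for the sigma-algebra G on D. *)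
Definition measurable_wrt (X : Type) d (Y : sigmaRingType d) (D : set X)
    (G : set (set X)) (f : X -> Y) : Prop :=
  preimage_set_system D f measurable `<=` G.

(* The product sigma-algebra of G and B[0, oo], on D = D1 * [0, oo]. *)
Definition prod_borel (R : realType) (X : Type) (D1 : set X)
    (G : set (set X)) : set (set (X * \bar R)) :=
  let D := D1 `*` [set u : \bar R | (0 <= u)%E] in
  <<s D, preimage_set_system D fst G `|` preimage_set_system D snd measurable >>.

Section paths.
Variable R : realType.

Definition cadlag_on (T : \bar R) (x : R -> R) : Prop :=
  forall t : R, 0 <= t -> (t%:E < T)%E ->
    x s @[s --> t^'+] --> x t /\ (0 < t -> cvg (x s @[s --> t^'-])).

Definition cadlag (x : R -> R) : Prop := cadlag_on +oo%E x.

Definition left_continuous_path (x : R -> R) : Prop :=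
  forall t : R, 0 < t -> x s @[s --> t^'-] --> x t.

(* The integral of h over a subset D of [0, oo] against da, where a is the
   path of a non-decreasing right-continuous process with values in [0, 1],
   extended by a = 0 on the negative reals (so that the Stieltjes measure has
   the mass a 0 at 0) and by a_oo = 1 (mass 1 - a_{oo-} at oo). *)
Definition integral_dA (a : cumulative R R) (D : set (\bar R))
    (h : \bar R -> \bar R) : \bar R :=
  (\int[lebesgue_stieltjes_measure a]_(v in `[0%R, +oo[ `&` (EFin @^-1` D))
      h v%:E
   + (\1_D +oo%E)%:E * h +oo%E * (1 - lim (a t @[t --> +oo%R]))%:E)%E.

End paths.

Section probability.
Context d (Om : measurableType d) (R : realType) (Q : probability Om R).

(* Y is a version of E[X | G], for X non-negative or integrable. *)
Definition cond_exp (G : set (set Om)) (X Y : Om -> \bar R) : Prop :=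
  measurable_wrt setT G Y /\
  forall B, G B -> (\int[Q]_(w in B) Y w = \int[Q]_(w in B) X w)%E.

(* The (Q, H)-null sets: the events contained in a Q-null element of H. *)
Definition null_sets (H : set (set Om)) : set (set Om) :=
  [set N | measurable N /\ exists B, [/\ H B, Q B = 0%E & N `<=` B]].

Definition sigma_of (X : Om -> \bar R) : set (set Om) :=
  preimage_set_system setT X measurable.

(* a \nmid b *)
Definition nmid (a b : \bar R) : \bar R := if (a <= b)%E then a else +oo%E.

Section filtration.
Variable F : R -> set (set Om).

Definition F_infty : set (set Om) :=
  <<s \bigcup_(t in [set t : R | 0 <= t]) F t >>.

Record filtration : Prop := {
  filtration_sigma_algebra : forall t : R, 0 <= t -> sigma_algebra setT (F t) ;
  filtration_measurable : forall t : R, 0 <= t -> F t `<=` measurable ;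
  filtration_nondecreasing : forall s t : R, 0 <= s -> s <= t -> F s `<=` F t ;
  filtration_right_continuous : forall t : R, 0 <= t ->
    F t = \bigcap_(s in [set s : R | t < s]) F s ;
  filtration_null_sets : forall t : R, 0 <= t -> null_sets F_infty `<=` F t }.

Definition adapted (X : R -> Om -> R) : Prop :=
  forall t : R, 0 <= t -> measurable_wrt setT (F t) (X t).

Definition stopping_time (S : Om -> \bar R) : Prop :=
  (forall w, 0 <= S w)%E /\
  forall t : R, 0 <= t -> F t [set w | (S w <= t%:E)%E].

Definition F_stop (S : Om -> \bar R) : set (set Om) :=
  [set B | F_infty B /\
    forall t : R, 0 <= t -> F t (B `&` [set w | (S w <= t%:E)%E])].

(* Om * R_+ *)
Definition time_domain : set (Om * R) := [set x | 0 <= x.2].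

Definition sigma_of_processes (P : set (R -> Om -> R)) : set (set (Om * R)) :=
  <<s time_domain, \bigcup_(X in P)
    preimage_set_system time_domain (fun x => X x.2 x.1) measurable >>.

Definition optional_sigma : set (set (Om * R)) :=
  sigma_of_processes [set X | adapted X /\ forall w, cadlag (X^~ w)].

Definition predictable_sigma : set (set (Om * R)) :=
  sigma_of_processes
    [set X | adapted X /\ forall w, left_continuous_path (X^~ w)].

Definition optional (X : R -> Om -> \bar R) : Prop :=
  measurable_wrt time_domain optional_sigma (fun x => X x.2 x.1).

Definition predictable (X : R -> Om -> R) : Prop :=
  measurable_wrt time_domain predictable_sigma (fun x => X x.2 x.1).

(* Y is a version of the optional projection of the process X. *)
Definition optional_projection (X Y : R -> Om -> \bar R) : Prop :=
  optional Y /\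
  forall S, stopping_time S ->
    let on_finite (V : R -> Om -> \bar R) (w : Om) : \bar R :=
      (V (fine (S w)) w * (\1_[set w' | (S w' < +oo)%E] w)%:E)%E in
    cond_exp (F_stop S) (on_finite X) (on_finite Y).

Definition martingale (M : R -> Om -> R) : Prop :=
  [/\ adapted M,
      forall t : R, 0 <= t -> Q.-integrable setT (EFin \o M t) &
      forall s t : R, 0 <= s -> s <= t ->
        cond_exp (F s) (EFin \o M t) (EFin \o M s)].

Definition stopped (M : R -> Om -> R) (S : Om -> \bar R) : R -> Om -> R :=
  fun t w => M (fine (mine t%:E (S w))) w.

Definition local_martingale (M : R -> Om -> R) : Prop :=
  [/\ adapted M,
      forall w, cadlag (M^~ w) &
      exists S : nat -> Om -> \bar R,
        [/\ forall n, stopping_time (S n),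
            forall n w, (S n w <= S n.+1 w)%E,
            {ae Q, forall w, S n w @[n --> \oo] --> +oo%E} &
            forall n, martingale (stopped M (S n))]].

Section random_time.
Variable tau : Om -> \bar R.

(* \mathcal{G}^0_t and \mathcal{G}_t *)
Definition G0_filtration (t : R) : set (set Om) :=
  \bigcap_(s in [set s : R | t < s])
    <<s F s `|` sigma_of (fun w => nmid (tau w) s%:E) >>.

Definition G_filtration (t : R) : set (set Om) :=
  <<s G0_filtration t `|` null_sets <<s F_infty `|` sigma_of tau >> >>.

Definition azema_supermartingale (Z : R -> Om -> R) : Prop :=
  (forall w, cadlag (Z^~ w)) /\
  forall t : R, 0 <= t ->
    cond_exp (F t) (fun w => (\1_[set w' | (t%:E < tau w')%E] w)%:E)
             (EFin \o Z t).

(* The paths of A are right-continuous and non-decreasing by typing; being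
   zero at negative times, they are non-negative. *)
Definition canonical_decomposition (Z M : R -> Om -> R)
    (A : Om -> cumulative R R) : Prop :=
  [/\ local_martingale M,
      predictable (fun t w => A w t),
      forall w (t : R), t < 0 -> A w t = 0 &
      {ae Q, forall w, forall t : R, 0 <= t -> Z t w = M t w - A w t}].

(* Path regularity in t holds for each u outside a null set that may depend
   on u, and regularity in u for each t outside a null set that may depend
   on t: in general no version has both for all (t, u) simultaneously. *)
Record iM_family (iM : \bar R -> R -> Om -> R) : Prop := {
  iM_itv01 : forall u (t : R) w, (0 <= u)%E -> 0 <= t -> 0 <= iM u t w <= 1 ;
  iM_martingale : forall u, (0 <= u)%E -> martingale (iM u) ;
  iM_cadlag : forall u, (0 <= u)%E ->
    {ae Q, forall w, cadlag (fun t => iM u t w)} ;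
  iM_cond_exp : forall u (t : R), (0 <= u)%E -> 0 <= t ->
    cond_exp (F t) (fun w => (\1_[set w' | (tau w' <= u)%E] w)%:E)
             (EFin \o iM u t) ;
  iM_nondecreasing : forall t : R, 0 <= t ->
    {ae Q, forall w, forall u v, (0 <= u)%E -> (u <= v)%E ->
      iM u t w <= iM v t w} ;
  iM_right_continuous : forall t : R, 0 <= t ->
    {ae Q, forall w, forall u : R, 0 <= u ->
      iM r%:E t w @[r --> u^'+] --> iM u%:E t w} }.

Definition iM_differentiable (iM : \bar R -> R -> Om -> R)
    (A : Om -> cumulative R R) (T : \bar R) : Prop :=
  forall t : R, 0 <= t -> (t%:E < T)%E ->
  exists p : Om * \bar R -> \bar R,
    [/\ forall w v, (0 <= v)%E -> (0 <= p (w, v))%E,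
        measurable_wrt (setT `*` [set v | (0 <= v)%E])
          (@prod_borel R Om setT (F t)) p &
        {ae Q, forall w, forall u : R, 0 <= u -> u <= t ->
          (iM u%:E t w)%:E =
          integral_dA (A w) [set v | 0 <= v <= u%:E]%E (fun v => p (w, v))}].

(* Om * [0, oo] *)
Definition prod_domain : set (Om * \bar R) := [set x | (0 <= x.2)%E].

Definition phi (w : Om) : Om * \bar R := (w, tau w).

Definition check_Q : set (Om * \bar R) -> \bar R := pushforward Q phi.

Definition check_F (t : R) : set (set (Om * \bar R)) :=
  preimage_set_system prod_domain fst (F t).

Definition check_G0 (t : R) : set (set (Om * \bar R)) :=
  \bigcap_(s in [set s : R | t < s])
    <<s prod_domain, check_F s `|`
      preimage_set_system prod_domain (fun x => nmid x.2 s%:E) measurable >>.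

(* The expectation under the Cox measure. *)
Definition cox_expectation (A : Om -> cumulative R R)
    (h : Om * \bar R -> \bar R) : \bar R :=
  (\int[Q]_w integral_dA (A w) [set v | 0 <= v] (fun v => h (w, v)))%E.

Definition density_process (Z : R -> Om -> R) (A : Om -> cumulative R R)
    (p : R -> Om * \bar R -> R) (t : R) (x : Om * \bar R) : R :=
  \1_[set y : Om * \bar R | (t%:E < y.2)%E] x * (Z t x.1 / (1 - A x.1 t))
  + \1_[set y : Om * \bar R | (y.2 <= t%:E)%E] x * p t x.

(* p t (w, u) is \mathsf{p}_{t+}(w, u). *)
Record regularized_density (Z : R -> Om -> R) (A : Om -> cumulative R R)
    (iM : \bar R -> R -> Om -> R) (T : \bar R)
    (p : R -> Om * \bar R -> R) : Prop := {
  density_ge0 : forall (t : R) x, 0 <= t -> (t%:E < T)%E -> prod_domain x ->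
    0 <= p t x ;
  density_adapted : forall t : R, 0 <= t -> (t%:E < T)%E ->
    measurable_wrt prod_domain (check_G0 t) (p t) ;
  density_cadlag : forall x, prod_domain x -> cadlag_on T (p^~ x) ;
  density_measurable : forall t : R, 0 <= t -> (t%:E < T)%E ->
    measurable_wrt prod_domain (check_G0 t) (density_process Z A p t) ;
  density_RN : forall t : R, 0 <= t -> (t%:E < T)%E ->
    forall B, check_G0 t B ->
      check_Q B = cox_expectation A
        (fun x => (\1_B x * density_process Z A p t x)%:E) ;
  density_iM : forall a t : R, 0 <= a -> a <= t -> (t%:E < T)%E ->
    {ae Q, forall w, (iM a%:E t w)%:E =
      integral_dA (A w) [set v | 0 <= v <= a%:E]%E
        (fun v => (p t (w, v))%:E)} }.

End random_time.

(* oH t (w, u) is (^oH)_t(w, u). *)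
Record param_optional_projection (H : Om * \bar R -> \bar R)
    (oH : R -> Om * \bar R -> \bar R) : Prop := {
  pop_measurable :
    measurable_wrt (time_domain `*` [set u | (0 <= u)%E])
      (@prod_borel R (Om * R)%type time_domain optional_sigma)
      (fun x => oH x.1.2 (x.1.1, x.2)) ;
  pop_diagonal : optional (fun t w => oH t (w, t%:E)) ;
  pop_section : forall u, (0 <= u)%E ->
    optional_projection (fun _ w => H (w, u)) (fun t w => oH t (w, u)) ;
  pop_stopping_optional : forall U, stopping_time U ->
    optional (fun t w =>
      (\1_[set w' | (U w' <= t%:E)%E] w)%:E * oH t (w, U w))%E ;
  pop_stopping : forall U S, stopping_time U -> stopping_time S ->
    (forall w, U w <= S w)%E ->
    forall B, F_stop S B -> B `<=` [set w | (S w < +oo)%E] ->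
    (\int[Q]_(w in B) H (w, U w) =
     \int[Q]_(w in B) oH (fine (S w)) (w, U w))%E }.

End filtration.

End probability.

(* Main.v *)
(* On {t < tau} the sigma-algebras G^0_t and F_t have the same trace, whence the first
   term.  On {tau <= t}, a set of G^0_t is pulled back by phi from a set B of check_G^0_t,
   and the density of check_Q with respect to the Cox measure at time b turns
   E[1_B(phi) f(phi); tau <= t] into the Cox integral of 1_B f p_b over {u <= t}.  Writing
   C_r = inf {v >= 0 | r <= A_v}, the Cox measure is the image of Q x dr under
   (w, r) |-> (w, C_r(w)).  Each C_r is a stopping time and {C_r <= t, (w, C_r) in B}
   belongs to F_t, so property (iii) of the parametrized projection, with U = C_r /\ t and
   S = t, replaces f p_b by its projection at time t for every level r.  The density at time
   t brings the integral back to Q; the sets {p_t = 0} and {projection < 0} are null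
   for check_Q on {u <= t}. *)

Require Import Defs.
From HB Require Import structures.
From mathcomp Require Import all_boot all_order all_algebra.
From mathcomp Require Import all_classical all_reals all_analysis.
From mathcomp Require Import measurable_realfun.

Set Implicit Arguments.
Unset Strict Implicit.
Unset Printing Implicit Defensive.

Import Order.TTheory GRing.Theory Num.Theory.
Import numFieldTopology.Exports numFieldNormedType.Exports.

Local Open Scope classical_set_scope.
Local Open Scope ring_scope.

(** * Integrals against transported measures *)

Section transfer.
Local Open Scope ereal_scope.
Import HBNNSimple.

(** Property (iii) of the projection accepts only graphs of stopping times, so the Cox measure has
    to be cut into such graphs; this is why it is disintegrated along levels and not along times.
    The level coordinate also replaces the measures dA(w), which depend on w, by the fixed Lebesgue
    measure, so that Tonelli applies on an ordinary product. Two further obstacles shape the proof.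
    The candidate for the conditional expectation is therefore set to 0 wherever a sign is wrong or
    a denominator is not positive. It is then non-negative everywhere, monotone convergence and
    Tonelli apply, and the cut is removed almost surely at the very end. Moreover G_t is a
    completion: the candidate is built and tested on G^0_t, and a set of G_t is exchanged for an
    almost surely equal set of G^0_t only when uniqueness is invoked. *)

Lemma integral_nnsfun_weight d d' (X : measurableType d) (Y : measurableType d')
    (R : realType) (m : {measure set X -> \bar R}) (phi : X -> Y) (g : X -> R)
    (h : {nnsfun Y >-> R}) :
  measurable_fun setT phi -> measurable_fun setT g -> (forall x, 0 <= g x)%R ->
  \int[m]_x (h (phi x) * g x)%:E =
  \sum_(k \in range h) k%:E * \int[m]_(x in phi @^-1` (h @^-1` [set k])) (g x)%:E.
Proof.
move=> mphi mg g0.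
have mhk k : measurable (phi @^-1` (h @^-1` [set k])).
  by rewrite -[X in measurable X]setTI; exact: mphi.
have hE x : (h (phi x) * g x)%:E =
    \sum_(k \in range h) (k%:E * ((EFin \o g) \_ (phi @^-1` (h @^-1` [set k]))) x).
  have -> : (h (phi x) * g x)%:E =
      (\sum_(k \in range h) (k * \1_(h @^-1` [set k]) (phi x))%:E) * (g x)%:E.
    by rewrite fsumEFin// -fimfunE EFinM.
  rewrite ge0_mule_fsuml//; last by move=> k; rewrite nnfun_muleindic_ge0.
  apply: eq_fsbigr => k _; rewrite EFinM -muleA; congr (_ * _).
  rewrite patchE indicE; case: ifPn => xk.
    by rewrite mem_set ?mul1e//; move: xk; rewrite inE.
  by rewrite memNset ?mul0e// => hk; move: xk; rewrite notin_setE; apply.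
under eq_integral do rewrite hE.
have kg0 k x : 0 <= k%:E * ((EFin \o g) \_ (phi @^-1` (h @^-1` [set k]))) x.
  rewrite patchE; case: ifPn => [|_]; last by rewrite mule0.
  by rewrite inE/= => <-; rewrite mule_ge0// lee_fin.
have mgk k : measurable_fun setT ((EFin \o g) \_ (phi @^-1` (h @^-1` [set k]))).
  apply/(measurable_restrictT _ (mhk k)); apply: measurable_funTS.
  exact/measurable_EFinP.
rewrite ge0_integral_fsum//; last first.
  by move=> k; apply: measurable_funeM; exact: mgk.
apply: eq_fsbigr => k /set_mem[y _ <-].
rewrite ge0_integralZl//; first by rewrite -integral_mkcond.
- by move=> x _; rewrite patchE; case: ifP => //; rewrite lee_fin.
- by rewrite lee_fin.
Qed.

(** Two weighted measures with the same image on [Y] integrate the functions of [Y] alike: the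
    equality passes from sets to simple functions and then to monotone limits. [Y] will carry a
    coarse sigma-algebra, the only one on which the two images are known to agree. *)
Lemma ge0_integral_transfer d1 d2 d3 (X1 : measurableType d1)
    (X2 : measurableType d2) (Y : measurableType d3) (R : realType)
    (m1 : {measure set X1 -> \bar R}) (m2 : {measure set X2 -> \bar R})
    (phi1 : X1 -> Y) (phi2 : X2 -> Y) (g1 : X1 -> R) (g2 : X2 -> R) :
  measurable_fun setT phi1 -> measurable_fun setT phi2 ->
  measurable_fun setT g1 -> measurable_fun setT g2 ->
  (forall x, 0 <= g1 x)%R -> (forall x, 0 <= g2 x)%R ->
  (forall B, measurable B -> \int[m1]_(x in phi1 @^-1` B) (g1 x)%:E =
                             \int[m2]_(x in phi2 @^-1` B) (g2 x)%:E) ->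
  forall f : Y -> \bar R, measurable_fun setT f -> (forall y, 0 <= f y) ->
  \int[m1]_x (f (phi1 x) * (g1 x)%:E) = \int[m2]_x (f (phi2 x) * (g2 x)%:E).
Proof.
move=> mphi1 mphi2 mg1 mg2 g10 g20 H f mf f0.
pose h := nnsfun_approx measurableT mf.
have key d (X : measurableType d) (m : {measure set X -> \bar R}) (phi : X -> Y)
    (g : X -> R) : measurable_fun setT phi -> measurable_fun setT g ->
    (forall x, 0 <= g x)%R -> \int[m]_x (f (phi x) * (g x)%:E) =
    limn (fun n => \int[m]_x (h n (phi x) * g x)%:E).
  move=> mphi mg g0; rewrite -monotone_convergence//.
  - apply: eq_integral => x _; apply/esym/cvg_lim => //.
    under eq_fun do rewrite EFinM.
    by apply: cvgeZr => //; exact: cvg_nnsfun_approx.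
  - move=> n; apply/measurable_EFinP/measurable_funM => //.
    exact: measurableT_comp.
  - by move=> n x _; rewrite lee_fin mulr_ge0.
  - move=> x _ a b ab; rewrite lee_fin; apply: ler_wpM2r => //.
    exact/lefP/nd_nnsfun_approx.
rewrite !key//; congr (limn _); apply/funext => n.
rewrite !integral_nnsfun_weight//; apply: eq_fsbigr => k _.
by rewrite H//; exact: measurable_funPTI.
Qed.

End transfer.
(** * Stieltjes measures and quantiles *)

Lemma measurable_fun_le_set d (X : measurableType d) (R : realType) (f : X -> \bar R) :
  (forall u : R, measurable [set x | (f x <= u%:E)%E]) -> measurable_fun setT f.
Proof.
move=> mf; apply: (measurability _ (ErealGenOInfty.measurableE R)) => _ [_ [u ->] <-].
rewrite setTI (_ : _ @^-1` _ = ~` [set x | (f x <= u%:E)%E]); first exact: measurableC.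
by apply/seteqP; split=> x /=; rewrite in_itv/= andbT ltNge => /negP.
Qed.

Section quantile.
Context {R : realType}.

Definition quantile (a : R -> R) (r : R) : \bar R :=
  ereal_inf [set v%:E | v in [set v | 0 <= v /\ r <= a v]].

Lemma quantile_ge0 (a : R -> R) (r : R) : (0 <= quantile a r)%E.
Proof. by apply/ereal_infP => _ [v [v0 _] <-]; rewrite lee_fin. Qed.

(** Right-continuity is what makes this an equivalence: if [a u < r], then [a] stays below [r] a
    little beyond [u], and the infimum lies strictly after [u]. *)
Lemma quantile_le (a : cumulative R R) (r u : R) :
  (quantile a r <= u%:E)%E = (0 <= u) && (r <= a u).
Proof.
apply/idP/idP => [qu|/andP[u0 rau]]; last first.
  by apply: ereal_inf_lbound; exists u.
rewrite -lee_fin (le_trans (quantile_ge0 a r) qu)/= leNgt; apply/negP => aur.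
have : \forall s \near u^'+, a s < r.
  have := @cumulative_is_right_continuous _ _ _ a u.
  by move=> /cvgr_lt; exact.
rewrite near_withinE => /nbhs_ballP[e /= e0 eu].
have : (((u + e / 2)%:E : \bar R) <= quantile a r)%E.
  apply/ereal_infP => _ [v [v0 rav] <-]; rewrite lee_fin leNgt; apply/negP => vu.
  have : a (u + e / 2) < r.
    apply: eu; last by rewrite ltrDl divr_gt0.
    rewrite /ball /= opprD addNKr normrN ger0_norm ?divr_ge0 ?ltW//.
    by rewrite ltr_pdivrMr// ltr_pMr// ltr1n.
  by apply/negP; rewrite -leNgt (le_trans rav)// cumulative_is_nondecreasing// ltW.
by move=> /le_trans/(_ qu); rewrite lee_fin gerDl leNgt divr_gt0.
Qed.

Lemma measurable_quantile d (X : measurableType d) (a : X -> cumulative R R)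
    (b : X -> R) :
  (forall u, 0 <= u -> measurable_fun setT (fun x => a x u)) ->
  measurable_fun setT b -> measurable_fun setT (fun x => quantile (a x) (b x)).
Proof.
move=> ma mb; apply: measurable_fun_le_set => u.
have [u0|u0] := leP 0 u; last first.
  rewrite (_ : [set _ | _] = set0) //; apply/seteqP; split=> x //=.
  by rewrite quantile_le leNgt u0.
rewrite (_ : [set _ | _] = (fun x => b x <= a x u) @^-1` [set true]); last first.
  by apply/seteqP; split=> x /=; rewrite quantile_le u0.
by rewrite -[X in measurable X]setTI; apply: measurable_fun_ler => //; exact: ma.
Qed.

(** Both conditions keep spurious mass away from 0: for an [a] that vanishes at negative times, the
    levels [r <= 0] have quantile 0 and infinite Lebesgue measure, and [fine] sends the quantile
    [+oo] of a level that is never reached to 0. *)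
Let qdom (a : cumulative R R) := [set r | 0 < r /\ (quantile a r < +oo)%E].

Let mquantile (a : cumulative R R) : measurable_fun [set: R] (quantile a).
Proof.
by apply: (@measurable_quantile _ _ (fun=> a) id) => // u _; exact: measurable_cst.
Qed.

Let measurable_qdom (a : cumulative R R) : measurable (qdom a).
Proof.
rewrite (_ : qdom a = `]0, +oo[%classic `&` [set r | (quantile a r < +oo)%E]).
  apply: measurableI; first exact: measurable_itv.
  have := @emeasurable_fun_infty_o _ _ _ setT _ measurableT (mquantile a) +oo%E.
  by rewrite setTI.
by apply/seteqP; split => r /=; rewrite in_itv/= andbT.
Qed.

(** By uniqueness of the Stieltjes measure only intervals []x, y]] matter, and the quantile pulls
    such an interval back to the levels []a x, a y]]. For [x < 0 <= y] these are []0, a y]], which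
    accounts for the mass [a 0] at 0. *)
Lemma lebesgue_stieltjes_quantile (a : cumulative R R) :
  (forall u, u < 0 -> a u = 0) -> forall B : set R, measurable B ->
  lebesgue_stieltjes_measure a B =
  lebesgue_measure (qdom a `&` (fine \o quantile a) @^-1` B).
Proof.
move=> a0 B mB.
have mq : measurable_fun setT (fine \o quantile a).
  by apply: measurableT_comp; [exact: fine_measurable|exact: mquantile].
have qin (u r : R) : qdom a r -> (fine (quantile a r) <= u) = (0 <= u) && (r <= a u).
  move=> [r0 qoo]; rewrite -quantile_le -[in RHS](@fineK _ (quantile a r)) ?lee_fin//.
  by rewrite ge0_fin_numE// quantile_ge0.
have qoo (u r : R) : 0 <= u -> r <= a u -> (quantile a r < +oo)%E.
  move=> u0 rau; have : (quantile a r <= u%:E)%E by rewrite quantile_le u0.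
  by move=> /le_lt_trans; apply; exact: ltry.
have age0 u : 0 <= a u.
  have [/a0 ->//|u0] := ltP u 0.
  rewrite -(a0 (-1)) ?ltrN10//; apply: cumulative_is_nondecreasing.
  by rewrite (le_trans _ u0)// lerN10.
pose f0 : measurableTypeR R -> measurableTypeR R := fine \o quantile a.
have mf0 : measurable_fun setT f0 by exact: mq.
pose mu : {measure set (measurableTypeR R) -> \bar R} :=
  measure_function_pushforward__canonical__measure_function_Measure
    [the measure _ _ of mrestr lebesgue_measure (measurable_qdom a)] mf0.
have muE X : mu X = lebesgue_measure (qdom a `&` (fine \o quantile a) @^-1` X).
  by rewrite /mu /= /pushforward /mrestr setIC.
rewrite -muE; apply: lebesgue_stieltjes_measure_unique => // _ [[x y] _ <-] /=.
rewrite muE; have [xy|yx] := leP x y; last first.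
  by rewrite set_itv_ge ?preimage_set0 ?setI0 ?measure0// -leNgt bnd_simp ltW.
rewrite /lebesgue_stieltjes_measure /measure_extension measurable_mu_extE/=; last exact: is_ocitv.
rewrite wlength_itv_bnd//.
have -> : qdom a `&` (fine \o quantile a) @^-1` `]x, y] = `]a x, a y]%classic.
  apply/seteqP; split=> r /=; rewrite !in_itv/=.
    move=> [qr]; rewrite ltNge !qin// => /andP[+ /andP[y0 ->]]; rewrite andbT.
    have [x0|x0] := leP 0 x; first by rewrite /= -ltNge.
    by move=> _; rewrite a0//; case: qr.
  move=> /andP[axr ray]; have r0 : 0 < r by exact: le_lt_trans axr.
  have y0 : 0 <= y by rewrite leNgt; apply/negP => /a0 ay0; move: ray; rewrite ay0 leNgt r0.
  have qr : qdom a r by split=> //; exact: (qoo y).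
  by split => //; rewrite ltNge !qin// y0 ray andbT negb_and -!ltNge axr orbT.
rewrite lebesgue_measure_itv/= lte_fin; case: ltP => [|ayx]; first by rewrite EFinB.
suff -> : a x = a y by rewrite subrr.
by apply/eqP; rewrite eq_le ayx cumulative_is_nondecreasing.
Qed.

(** Since [h] vanishes at [+oo], the levels with infinite quantile contribute nothing, and the
    weight [qdom a] simplifies to positivity of the level, which does not depend on [a]. *)
Lemma integral_stieltjes_quantile (a : cumulative R R) (h : \bar R -> \bar R) :
  (forall u, u < 0 -> a u = 0) ->
  measurable_fun setT h -> (forall u, 0 <= h u)%E -> h +oo%E = 0%E ->
  (\int[lebesgue_stieltjes_measure a]_v h v%:E =
   \int[lebesgue_measure]_r (h (quantile a r) * (\1_[set s : R | 0 < s] r)%:E))%E.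
Proof.
move=> a0 mh h0 hoo.
have mg : measurable_fun [set: R] (\1_(qdom a) : R -> R) by exact: measurable_indic.
have mE : measurable_fun [set: R] (@EFin R) by exact: EFin_measurable.
have := @ge0_integral_transfer _ _ _ (measurableTypeR R) (measurableTypeR R) _ R
  (lebesgue_stieltjes_measure a) lebesgue_measure EFin (quantile a) (cst 1) (\1_(qdom a))
  mE (mquantile a) (@measurable_cst _ _ _ _ setT (1 : R)) mg.
move=> /(_ (fun=> ler01) _ _ h mh h0).
under eq_integral do rewrite mule1.
move=> ->; first last.
- move=> B mB.
  have mEB : measurable (@EFin R @^-1` B) by rewrite -[X in measurable X]setTI; exact: mE.
  have mqB : measurable (quantile a @^-1` B).
    by rewrite -[X in measurable X]setTI; exact: mquantile.
  rewrite integral_indic//; last exact: measurable_qdom.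
  transitivity (lebesgue_stieltjes_measure a (EFin @^-1` B)).
    by rewrite -[RHS]mul1e -integral_cst.
  rewrite lebesgue_stieltjes_quantile//.
  congr (lebesgue_measure _); apply/seteqP; split => r [[r0 qr]] /=.
    by rewrite fineK// ge0_fin_numE// quantile_ge0.
  by move=> Bq; split => //; rewrite fineK// ge0_fin_numE// quantile_ge0.
- by move=> r; rewrite indicE; case: (_ \in _); rewrite ?ler01.
apply: eq_integral => r _; rewrite !indicE.
have [r0|r0] := ltP 0 r; last first.
  by rewrite memNset ?memNset//= ?ltNge ?r0// => -[]; rewrite ltNge r0.
have -> : (r \in [set s : R | 0 < s]) = true by rewrite mem_set.
have [qr|] := ltP (quantile a r) +oo%E; first by rewrite mem_set.
by rewrite leye_eq => /eqP ->; rewrite hoo !mul0e.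
Qed.
End quantile.
(** * Sigma-algebras *)

Section sigma_algebras.
Context {X X' : Type}.

Lemma sigma_algebra_comap (D : set X) (D' : set X') (Phi : X' -> X)
    (H : set (set X')) :
  sigma_algebra D' H -> (forall x, D' x -> D (Phi x)) ->
  sigma_algebra D [set B | H (D' `&` Phi @^-1` B)].
Proof.
move=> [H0 HD HU] DPhi; split => /=.
- by rewrite preimage_set0 setI0.
- move=> A HA; rewrite (_ : _ `&` _ = D' `\` (D' `&` Phi @^-1` A)); first exact: HD.
  apply/seteqP; split=> x /=; first by move=> [D'x [_ nA]]; split=> // -[].
  by move=> [D'x nA]; split=> //; split; [exact: DPhi|move=> Ax; exact: nA].
- by move=> A HA; rewrite preimage_bigcup setI_bigcupr; exact: HU.
Qed.

(** The good-sets principle for sigma-algebras on subsets: measurability of a pullback is checked on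
    generators only. *)
Lemma sub_sigma_algebra_comap (D : set X) (D' : set X') (Phi : X' -> X)
    (G : set (set X)) (H : set (set X')) :
  sigma_algebra D' H -> (forall x, D' x -> D (Phi x)) ->
  (forall B, G B -> H (D' `&` Phi @^-1` B)) ->
  forall B, <<s D, G >> B -> H (D' `&` Phi @^-1` B).
Proof.
move=> sH DPhi GH; apply: smallest_sub => //.
exact: sigma_algebra_comap.
Qed.

End sigma_algebras.

Section sigma_algebras1.
Context {X : Type}.
Implicit Types (D : set X) (G : set (set X)).

Lemma sigma_algebra_ext D G :
  sigma_algebra D G -> sigma_algebra setT [set B | G (D `&` B)].
Proof. by move=> sG; exact: (@sigma_algebra_comap _ _ setT D id G sG). Qed.

Lemma sigma_algebra_setU D G A B : sigma_algebra D G -> G A -> G B -> G (A `|` B).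
Proof.
move=> [G0 _ GU] GA GB; rewrite -bigcup2E; apply: GU => -[|[|n]] //=.
Qed.

Lemma sigma_algebra_setI D G A B : sigma_algebra D G -> A `<=` D ->
  G A -> G B -> G (A `&` B).
Proof.
move=> sG AD GA GB; have [G0 GD GU] := sG.
rewrite (_ : A `&` B = D `\` ((D `\` A) `|` (D `\` B))).
  by apply: (GD); apply: (sigma_algebra_setU sG); exact: GD.
apply/seteqP; split=> x /=.
  by move=> [Ax Bx]; split; [exact: AD|move=> [|] []].
move=> [Dx nx]; split; apply: contrapT => n; apply: nx; [left|right] => //.
Qed.

(** No trace of [G] has to be formed: being a sigma-algebra on [L] only asks for stability under
    complements within [L]. This allows work on the part {u <= t} of the product space. *)
Lemma sigma_algebra_sub D G L : sigma_algebra D G -> G L -> L `<=` D ->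
  sigma_algebra L G.
Proof.
move=> sG GL LD; have [G0 GD GU] := sG; split=> // A GA.
rewrite (_ : L `\` A = L `&` (D `\` A)).
  by apply: (sigma_algebra_setI sG LD GL); exact: GD.
by apply/seteqP; split=> x /=; [move=> [Lx nA]; split=> //; split=> //; exact: LD|move=> [Lx []]].
Qed.

Lemma sigma_algebra_bigcap_seq G (B : (set X)^nat) : sigma_algebra setT G ->
  (forall n, G (B n)) -> G (\bigcap_n B n).
Proof.
move=> [G0 GD GU] GB; rewrite -(setCK (\bigcap_n B n)) setC_bigcap -setTD.
by apply/GD/GU => n; rewrite -setTD; exact: GD.
Qed.

(* A right limit of sets: the limsup of the approximations [C_(t + 1/n)] belongs
   to every [H s], since dropping finitely many terms does not change it. *)
Lemma right_limit_set {X' : Type} {R : realType} (t : R) (H : R -> set (set X))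
    (Phi : X' -> X) (E : R -> set X') (B : set X') :
  (forall s, t < s -> sigma_algebra setT (H s)) ->
  (forall s s', t < s -> s <= s' -> H s `<=` H s') ->
  (forall s s', t < s -> s <= s' -> E s' `<=` E s) ->
  (forall s, t < s -> exists2 C, H s C & E s `&` Phi @^-1` C = E s `&` B) ->
  exists2 L, (forall s, t < s -> H s L) &
    forall s x, t < s -> E s x -> L (Phi x) <-> B x.
Proof.
move=> sH mH mE HC.
have tn n : t < t + n.+1%:R^-1 by rewrite ltrDl invr_gt0.
have mn n m : (n <= m)%N -> t + m.+1%:R^-1 <= t + n.+1%:R^-1.
  by move=> nm; rewrite lerD2l lef_pV2 ?posrE// ler_nat ltnS.
have /choice[C HCn] : forall n, exists C, H (t + n.+1%:R^-1) C /\
    E (t + n.+1%:R^-1) `&` Phi @^-1` C = E (t + n.+1%:R^-1) `&` B.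
  by move=> n; have [C HC1 HC2] := HC _ (tn n); exists C.
have big s : t < s -> exists N, t + N.+1%:R^-1 <= s.
  move=> ts; have st0 : 0 < s - t by rewrite subr_gt0.
  exists (Num.bound (s - t)^-1); rewrite -lerBrDl.
  rewrite -[leRHS]invrK lef_pV2 ?posrE ?invr_gt0//.
  have := @archi_boundP _ (s - t)^-1; rewrite invr_ge0 (ltW st0) => /(_ isT) /ltW.
  by move=> /le_trans; apply; rewrite ler_nat.
exists (\bigcap_n \bigcup_k C (n + k)%N).
  move=> s ts; have [N Ns] := big _ ts.
  rewrite (_ : \bigcap_n _ = \bigcap_n \bigcup_k C (N + n + k)%N).
    apply: sigma_algebra_bigcap_seq; first exact: sH.
    move=> n; have [_ _] := sH _ ts; apply => k.
    apply: (mH (t + (N + n + k).+1%:R^-1)) => //; last exact: (HCn _).1.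
    by rewrite (le_trans _ Ns)// mn// -addnA leq_addr.
  apply/seteqP; split=> x /= Cx n _.
    exact: (Cx (N + n)%N).
  have [k _ Ck] := Cx n Logic.I; exists (N + k)%N => //.
  by rewrite addnCA addnA.
move=> s x ts Esx; have [N Ns] := big _ ts.
have CB n : (N <= n)%N -> C n (Phi x) <-> B x.
  move=> Nn; have [_ HE] := HCn n.
  have En : E (t + n.+1%:R^-1) x.
    by apply: mE Esx => //; rewrite (le_trans _ Ns)// mn.
  split=> Cx.
    have : (E (t + n.+1%:R^-1) `&` B) x by rewrite -HE.
    by case.
  have : (E (t + n.+1%:R^-1) `&` Phi @^-1` C n) x by rewrite HE.
  by case.
split=> [/(_ N Logic.I)[k _ /CB]|Bx n _]; first by apply; rewrite leq_addr.
by exists N => //; apply/CB => //; rewrite leq_addl.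
Qed.

End sigma_algebras1.

Section measurable_wrt_type.
Context {X : pointedType} (G : set (set X)) (sG : sigma_algebra setT G).

Lemma measurable_wrtP d (Y : sigmaRingType d) (f : X -> Y) :
  measurable_wrt setT G f <-> measurable_fun (setT : set (g_sigma_algebraType G)) f.
Proof.
split=> mf.
  by move=> _ B mB; rewrite measurable_g_measurableTypeE//; apply: mf; exists B.
by move=> _ [B mB <-]; rewrite -(measurable_g_measurableTypeE sG); exact: mf.
Qed.

End measurable_wrt_type.

Lemma measurable_nmid (R : realType) (s : R) :
  measurable_fun setT (fun u : \bar R => nmid u s%:E).
Proof.
apply: measurable_fun_ifT => //.
by apply: measurable_fun_lee => //; exact: measurable_cst.
Qed.

(** * Null sets from signs of integrals, and almost sure uniqueness *)

Section positivity_uniqueness.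
Local Open Scope ereal_scope.
Context d (X : measurableType d) (R : realType) (m : {measure set X -> \bar R}).

Lemma measure0_integral_pos (B : set X) (f : X -> \bar R) :
  measurable B -> measurable_fun B f -> (forall x, B x -> 0 < f x) ->
  \int[m]_(x in B) f x = 0 -> m B = 0.
Proof.
move=> mB mf f0 If0.
have /(ae_eq_integral_abs m mB mf) : \int[m]_(x in B) `|f x| = 0.
  rewrite -If0; apply: eq_integral => x /set_mem Bx.
  by rewrite gee0_abs// ltW// f0.
move=> [N [mN N0 sN]]; apply/eqP; rewrite -measure_le0.
rewrite -N0; apply: le_measure; rewrite ?inE// => x Bx; apply: sN => /= /(_ Bx) fx.
by have := f0 _ Bx; rewrite fx ltxx.
Qed.

(** The tool for signs of versions: where a version is negative, its integral still equals that of a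
    non-negative variable. *)
Lemma measure0_integral_neg (B : set X) (f : X -> \bar R) :
  measurable B -> measurable_fun B f -> (forall x, B x -> f x < 0) ->
  0 <= \int[m]_(x in B) f x -> m B = 0.
Proof.
move=> mB mf f0 If0.
apply: (@measure0_integral_pos B (fun x => - f x)) => //.
- exact: measurableT_comp.
- by move=> x Bx; rewrite oppe_gt0 f0.
have h0 : 0 <= \int[m]_(x in B) - f x.
  by apply: integral_ge0 => x Bx; rewrite oppe_ge0 ltW// f0.
apply/eqP; rewrite eq_le h0 andbT.
have : \int[m]_(x in B) f x = - \int[m]_(x in B) (- f x).
  rewrite -integral_ge0N//; last by move=> x Bx; rewrite oppe_ge0 ltW// f0.
  by under [RHS]eq_integral do rewrite oppeK.
by move=> IE; move: If0; rewrite IE oppe_ge0.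
Qed.

End positivity_uniqueness.

Section cond_exp_unique.
Local Open Scope ereal_scope.
Context d (X : measurableType d) (R : realType) (P : probability X R).

(** The bound [n] makes [f] integrable, and the equality of integrals passes this on to [g]; only
    then may the two integrals be subtracted. *)
Let measure0_lt_integral_eq (B : set X) (f g : X -> \bar R) (n : nat) :
  measurable B -> measurable_fun B f -> measurable_fun B g ->
  (forall x, B x -> 0 <= f x) -> (forall x, B x -> f x < g x) ->
  (forall x, B x -> f x <= n%:R%:E) ->
  \int[P]_(x in B) f x = \int[P]_(x in B) g x -> P B = 0.
Proof.
move=> mB mf mg f0 fg fn Ifg.
have intf : P.-integrable B f.
  apply: (@le_integrable _ _ _ P B mB f (cst n%:R%:E)) => //.
    by move=> x Bx; rewrite !gee0_abs ?fn ?f0// lee_fin.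
  exact: finite_measure_integrable_cst.
have g0 x : B x -> 0 <= g x by move=> Bx; rewrite (le_trans (f0 _ Bx))// ltW// fg.
have intg : P.-integrable B g.
  apply/integrableP; split => //.
  have -> : \int[P]_(x in B) `|g x| = \int[P]_(x in B) `|f x|.
    transitivity (\int[P]_(x in B) f x); [rewrite Ifg|];
      by apply: eq_integral => x /set_mem Bx; rewrite gee0_abs// ?g0 ?f0.
  by have /integrableP[] := intf.
apply: (@measure0_integral_pos _ _ _ _ _ (fun x => g x - f x)) => //.
- exact: emeasurable_funB.
- by move=> x Bx; rewrite sube_gt0 fg.
rewrite integralB// Ifg subee//; exact: integrable_fin_num.

Qed.

(** Neither function need be integrable. Once {g < 0} is known to be null, the set where the two
    differ is a countable union of pieces on which the smaller function is bounded, hence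
    integrable. *)
Lemma ae_eq_of_integral_eq (G : set (set X)) (f g : X -> \bar R) :
  sigma_algebra setT G -> G `<=` measurable ->
  measurable_wrt setT G f -> measurable_wrt setT G g ->
  (forall x, 0 <= f x) ->
  (forall B, G B -> 0 <= \int[P]_(x in B) g x) ->
  (forall B, G B -> \int[P]_(x in B) f x = \int[P]_(x in B) g x) ->
  {ae P, forall x, g x = f x}.
Proof.
move=> sG GM mf mg f0 Ig0 Ifg.
pose Y := g_sigma_algebraType G.
have YE (B : set X) : measurable (B : set Y) -> G B.
  by rewrite (measurable_g_measurableTypeE sG).
have mfY : measurable_fun (setT : set Y) (f : Y -> \bar R) by exact/measurable_wrtP.
have mgY : measurable_fun (setT : set Y) (g : Y -> \bar R) by exact/measurable_wrtP.
have toX (h : X -> \bar R) : measurable_fun (setT : set Y) (h : Y -> \bar R) ->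
    measurable_fun setT h.
  by move=> mh _ B mB; apply/GM/YE; exact: mh.
have ltY (h1 h2 : Y -> \bar R) : measurable_fun setT h1 -> measurable_fun setT h2 ->
    G [set x | h1 x < h2 x].
  move=> m1 m2; apply: YE; rewrite -[X in measurable X]setTI.
  exact: emeasurable_fun_lt.
have leY (h1 h2 : Y -> \bar R) : measurable_fun setT h1 -> measurable_fun setT h2 ->
    G [set x | h1 x <= h2 x].
  move=> m1 m2; apply: YE; rewrite -[X in measurable X]setTI.
  exact: emeasurable_fun_le.
have GI (A B : set X) : G A -> G B -> G (A `&` B).
  exact: (sigma_algebra_setI sG (@subsetT _ _)).
have gneg : P [set x | g x < 0] = 0.
  have GN := ltY g (cst 0) mgY (@measurable_cst _ _ _ _ _ _).
  apply: (@measure0_integral_neg _ _ _ _ _ g) => //; first exact: GM.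
    exact/measurable_funTS/toX.
  exact: Ig0.
pose B1 n := [set x | f x < g x] `&` [set x | f x <= n%:R%:E].
pose B2 n := [set x | 0 <= g x] `&` [set x | g x < f x] `&` [set x | g x <= n%:R%:E].
have GB1 n : G (B1 n) by apply: (GI); [exact: ltY|apply: leY].
have GB2 n : G (B2 n) by apply: (GI); [apply: (GI); [exact: leY|exact: ltY]|apply: leY].
have B10 n : P (B1 n) = 0.
  apply: (@measure0_lt_integral_eq _ f g n) => //; first exact: GM.
  - exact/measurable_funTS/toX.
  - exact/measurable_funTS/toX.
  - by move=> x [].
  - by move=> x [].
  - exact: Ifg.
have B20 n : P (B2 n) = 0.
  apply: (@measure0_lt_integral_eq _ g f n) => //; first exact: GM.
  - exact/measurable_funTS/toX.
  - exact/measurable_funTS/toX.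
  - by move=> x [[]].
  - by move=> x [[]].
  - by move=> x [].
  - by apply/esym/Ifg.
have big (a : \bar R) : 0 <= a -> a < +oo -> exists n, a <= n%:R%:E.
  case: a => // a; rewrite lee_fin => a0 _; exists (Num.bound a); rewrite lee_fin.
  by apply/ltW; exact: archi_boundP.
apply: (@negligibleS _ _ _ _ ([set x | g x < 0] `|` (\bigcup_n B1 n `|` \bigcup_n B2 n))).
  move=> x /= gfx; have [gx0|gx0] := ltP (g x) 0; first by left.
  right; have [fg|gf|/esym//] := ltgtP (f x) (g x).
    have [n fn] := big (f x) (f0 x) (lt_le_trans fg (leey _)).
    by left; exists n.
  have [n gn] := big (g x) gx0 (lt_le_trans gf (leey _)).
  by right; exists n.
have null N : G N -> P N = 0 -> P.-negligible N.
  by move=> GN PN; exists N; split=> //; exact: GM.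
apply: negligibleU; first by apply: null => //; exact: ltY.
by apply: negligibleU; apply: negligible_bigcup => n; exact: null.
Qed.

End cond_exp_unique.

(** * Time sections of processes and the sigma-algebras of the product space *)

Section filtration_facts.
Context d (Om : measurableType d) (R : realType) (Q : probability Om R).
Context (F : R -> set (set Om)) (hF : filtration Q F).
Local Notation D := (@prod_domain d Om R).

Let sF t : 0 <= t -> sigma_algebra setT (F t).
Proof. exact: filtration_sigma_algebra hF _. Qed.

Lemma filtration_bigcap (t : R) (B : set Om) :
  0 <= t -> (forall s, t < s -> F s B) -> F t B.
Proof. by move=> t0 FB; rewrite (filtration_right_continuous hF t0). Qed.

Lemma F_sub_F_infty (t : R) : 0 <= t -> F t `<=` F_infty F.
Proof. by move=> t0 B FB; apply: sub_sigma_algebra; exists t. Qed.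

Lemma F_infty_measurable : F_infty F `<=` measurable.
Proof.
apply: smallest_sub; first exact: sigma_algebra_measurable.
by move=> B [t t0]; exact: (filtration_measurable hF t0).
Qed.

Lemma prod_domainE : setT `*` [set v : \bar R | (0 <= v)%E] = D.
Proof. by apply/seteqP; split => [x []|x]. Qed.

(** Freezing the time at [u] turns a generating process [X] into the [F u]-measurable [X u]. This
    serves the predictable and the optional sigma-algebra alike. *)
Lemma section_sigma_of_processes (P : set (R -> Om -> R)) (u : R) :
  0 <= u -> (forall X, P X -> adapted F X) ->
  forall B, sigma_of_processes P B -> F u [set w | B (w, u)].
Proof.
move=> u0 PF B PB; rewrite -[X in F u X]setTI.
apply: (@sub_sigma_algebra_comap _ _ (@time_domain _ Om R) setT (fun w => (w, u)) _ (F u) _ _ _ _ PB) => //.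
- exact: sF.
- move=> _ [X /PF PX [V mV <-]]; apply: PX => //; exists V => //.
  by apply/seteqP; split=> w /= [] *; do ?split => //; tauto.
Qed.

Lemma predictable_adapted (X : R -> Om -> R) : predictable F X -> adapted F X.
Proof.
move=> pX u u0 _ [V mV <-].
have := @section_sigma_of_processes _ u u0 _ _ (pX _ (ex_intro2 _ _ V mV erefl)).
move=> h; rewrite (_ : _ `&` _ = [set w | (@time_domain d Om R `&` (fun x : Om * R => X x.2 x.1) @^-1` V) (w, u)]).
  by apply: h => Y []. 
by apply/seteqP; split=> w /= [] *; do ?split => //; tauto.
Qed.

Lemma pop_section_measurable (g : Om * R * \bar R -> \bar R) (u : R) : 0 <= u ->
  measurable_wrt (@time_domain _ Om R `*` [set v : \bar R | (0 <= v)%E])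
    (@prod_borel R (Om * R)%type (@time_domain _ Om R) (optional_sigma F)) g ->
  measurable_wrt D (@prod_borel R Om setT (F u)) (fun x => g ((x.1, u), x.2)).
Proof.
move=> u0 mg _ [V mV <-].
set tD := _ `*` _ in mg.
have := mg _ (ex_intro2 _ _ V mV erefl).
rewrite -prod_domainE.
move=> /(@sub_sigma_algebra_comap _ _ tD (setT `*` [set v : \bar R | (0 <= v)%E])
  (fun x => ((x.1, u), x.2)) _ (prod_borel setT (F u))) h.
rewrite (_ : _ `&` _ = setT `*` [set v : \bar R | (0 <= v)%E] `&`
   (fun x : Om * \bar R => (x.1, u, x.2)) @^-1` (tD `&` g @^-1` V)); last first.
  by apply/seteqP; split=> x /=; [move=> [[_ x2]]|move=> [[_ x2] []]].
apply: h.
- exact: smallest_sigma_algebra.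
- by move=> x [_ x2]; split.
- move=> _ [[W oW <-]|[W mW <-]].
    apply: sub_sigma_algebra; left; exists [set w | W (w, u)].
      by apply: (section_sigma_of_processes u0 _ oW) => Y [].
    by apply/seteqP; split=> x /=; [move=> [[_ x2] Wx]|move=> [[_ x2] [_ Wx]]].
  apply: sub_sigma_algebra; right; exists W => //.
  by apply/seteqP; split=> x /=; [move=> [[_ x2] Wx]|move=> [[_ x2] [_ Wx]]].
Qed.

(* [check_gen s] is \check{F}_s \vee \sigma(\hat\tau \nmid s). *)
Definition check_gen (s : R) : set (set (Om * \bar R)) :=
  <<s D, check_F F s `|`
    preimage_set_system D (fun x => nmid x.2 s%:E) measurable >>.

Lemma check_gen_sigma s : sigma_algebra D (check_gen s).
Proof. exact: smallest_sigma_algebra. Qed.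

Lemma check_genF s B : F s B -> check_gen s (D `&` fst @^-1` B).
Proof. by move=> FB; apply: sub_sigma_algebra; left; exists B. Qed.

Lemma check_gen_nmid s V : measurable V ->
  check_gen s (D `&` (fun x => nmid x.2 s%:E) @^-1` V).
Proof. by move=> mV; apply: sub_sigma_algebra; right; exists V. Qed.

Lemma check_gen_comap (X' : Type) (s : R) (Phi : X' -> Om * \bar R)
    (H : set (set X')) :
  sigma_algebra setT H -> (forall x, D (Phi x)) ->
  (forall B, F s B -> H ((fst \o Phi) @^-1` B)) ->
  (forall V, measurable V -> H ((fun x => nmid (Phi x).2 s%:E) @^-1` V)) ->
  forall B, check_gen s B -> H (Phi @^-1` B).
Proof.
move=> sH DPhi HF Hn B cB; rewrite -[X in H X]setTI.
apply: (@sub_sigma_algebra_comap _ _ D setT Phi _ H sH _ _ _ cB) => //.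
move=> _ [[V FV <-]|[V mV <-]]; rewrite setTI.
  rewrite (_ : _ @^-1` _ = (fst \o Phi) @^-1` V); first exact: HF.
  by apply/seteqP; split=> x /=; [case|split].
rewrite (_ : _ @^-1` _ = (fun x => nmid (Phi x).2 s%:E) @^-1` V); first exact: Hn.
by apply/seteqP; split=> x /=; [case|split].
Qed.

(** What is observed of [u] up to [s] is a function of what is observed up to a later [s']; hence
    [check_gen] is non-decreasing. *)
Lemma nmid_nmid (u : \bar R) (s s' : R) : s <= s' ->
  nmid (nmid u s'%:E) s%:E = nmid u s%:E.
Proof.
move=> ss'; rewrite {2 3}/nmid /=; case: (leP u s'%:E) => // s'u.
rewrite /nmid leye_eq /= ifF// leNgt (le_lt_trans _ s'u)//.
Qed.

Lemma check_gen_le s s' : 0 <= s -> s <= s' -> check_gen s `<=` check_gen s'.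
Proof.
move=> s0 ss'; apply: smallest_sub; first exact: check_gen_sigma.
move=> _ [[B FB <-]|[V mV <-]].
  by apply: check_genF; exact: (filtration_nondecreasing hF s0 ss').
rewrite (_ : _ `&` _ = D `&` (fun x => nmid x.2 s'%:E) @^-1`
   ((fun u => nmid u s%:E) @^-1` V)); last first.
  by apply/seteqP; split=> x /= [Dx Vx]; split=> //; move: Vx; rewrite nmid_nmid.
by apply: check_gen_nmid; rewrite -[X in measurable X]setTI; exact: measurable_nmid.
Qed.

Lemma check_G0_sigma t : sigma_algebra D (check_G0 F t).
Proof. by apply: sigma_algebra_bigcap => s _; exact: check_gen_sigma. Qed.

Lemma check_G0_le s t : s <= t -> check_G0 F s `<=` check_G0 F t.
Proof. by move=> st B sB u /= tu; apply: sB; exact: le_lt_trans tu. Qed.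

Lemma check_gen_measurable s : 0 <= s -> check_gen s `<=` measurable.
Proof.
move=> s0.
have mD : measurable D.
  by rewrite -prod_domainE; apply: measurableX => //; rewrite -set_itvcy; exact: emeasurable_itv.
apply: smallest_sub.
  split=> //; first by move=> A mA; exact: measurableD.
  by move=> A mA; exact: bigcup_measurable.
move=> _ [[B FB <-]|[V mV <-]]; apply: measurableI => //.
  rewrite -[X in measurable X]setTI; apply: measurable_fst => //.
  exact: (filtration_measurable hF s0).
rewrite -[X in measurable X]setTI.
by apply: (measurableT_comp (@measurable_nmid R s) measurable_snd).
Qed.

(* [check_G0] is a sigma-algebra on [prod_domain] only; a measurableType needs one on
   the whole of [Om * \bar R]. *)
Definition check_G0_ext (t : R) : set (set (Om * \bar R)) :=
  [set B | check_G0 F t (D `&` B)].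

Lemma check_G0_ext_sigma t : sigma_algebra setT (check_G0_ext t).
Proof. exact: sigma_algebra_ext (check_G0_sigma t). Qed.

Lemma measurable_check_G0P t d' (Y : sigmaRingType d') (f : Om * \bar R -> Y) :
  measurable_wrt D (check_G0 F t) f <->
  measurable_fun (setT : set (g_sigma_algebraType (check_G0_ext t))) f.
Proof.
rewrite -(measurable_wrtP (check_G0_ext_sigma t)); split=> mf _ [V mV <-].
  by rewrite setTI; apply: mf; exists V.
by have := mf _ (ex_intro2 _ _ V mV erefl); rewrite setTI.
Qed.

Lemma check_G0_ext_measurable t B : 0 <= t -> check_G0_ext t B ->
  measurable (D `&` B).
Proof.
move=> t0 cB; apply: (@check_gen_measurable (t + 1)); first by rewrite addr_ge0.
by apply: cB => /=; rewrite ltrDl.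
Qed.

(** Values in [D] are essential: [check_G0_ext t] contains every set disjoint from [D], measurable
    or not. *)
Lemma measurable_to_check_G0 t d' (X' : measurableType d') (Phi : X' -> Om * \bar R) :
  0 <= t -> measurable_fun setT Phi -> (forall x, D (Phi x)) ->
  measurable_fun setT (Phi : X' -> g_sigma_algebraType (check_G0_ext t)).
Proof.
move=> t0 mPhi DPhi _ B; rewrite measurable_g_measurableTypeE//; last exact: check_G0_ext_sigma.
move=> cB; rewrite (_ : Phi @^-1` B = Phi @^-1` (D `&` B)).
  by apply: mPhi => //; exact: check_G0_ext_measurable cB.
by apply/seteqP; split=> x /=; [move=> Bx; split=> //; exact: DPhi|case].
Qed.

(* On {u <= t} the maps [nmid u s], s > t, are the identity, hence [u] itself is
   measurable there. *)
Lemma prod_borel_check_G0 t : 0 <= t -> forall B, prod_borel setT (F t) B ->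
  check_G0 F t (D `&` [set x | (x.2 <= t%:E)%E] `&` B).
Proof.
move=> t0 B pB s /= ts.
set L := D `&` _.
have LE (V : set (\bar R)) : L `&` snd @^-1` V =
    D `&` (fun x => nmid x.2 s%:E) @^-1` (V `&` [set u | (u <= t%:E)%E]).
  apply/seteqP; split=> x /=.
    move=> [[Dx xt] Vx]; split=> //; rewrite /nmid.
    by rewrite (le_trans xt) ?lee_fin// ltW.
  rewrite /nmid; case: (leP x.2 s%:E) => _ [Dx [Vx xt]] //; by split.
have mt : measurable [set u : \bar R | (u <= t%:E)%E].
  by rewrite -set_itvNyc; exact: emeasurable_itv.
have cL : check_gen s L.
  rewrite -[L]setIT -(preimage_setT snd) LE; apply: check_gen_nmid.
  exact: measurableI.
have sL : sigma_algebra L (check_gen s).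
  apply: (sigma_algebra_sub (check_gen_sigma s) cL); exact: subIsetl.
apply: (@sub_sigma_algebra_comap _ _ _ L id _ _ sL _ _ _ pB).
  by move=> x [Dx _]; rewrite prod_domainE.
move=> _ [[V FV <-]|[V mV <-]]; rewrite preimage_id.
  rewrite (_ : L `&` _ = L `&` (D `&` fst @^-1` V)).
    apply: (sigma_algebra_setI (check_gen_sigma s) _ cL); first exact: subIsetl.
    by apply: check_genF; exact: (filtration_nondecreasing hF t0 (ltW ts)).
  by rewrite -prod_domainE.
rewrite (_ : L `&` _ = L `&` snd @^-1` V).
  by rewrite LE; apply: check_gen_nmid; exact: measurableI.
by rewrite prod_domainE setIA (@setIidl _ L)//; exact: subIsetl.
Qed.

(** Along the graph of an [F t]-measurable [U], observing the second coordinate adds nothing to the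
    filtration. This places the section in [F s] for each [s > t], and right-continuity brings it
    down to [F t]. *)
Lemma check_G0_section t (U : Om -> \bar R) B : 0 <= t ->
  measurable_wrt setT (F t) U -> (forall w, 0 <= U w)%E ->
  check_G0_ext t B -> F t [set w | B (w, U w)].
Proof.
move=> t0 mU U0 cB; apply: filtration_bigcap => // s ts.
rewrite (_ : [set _ | _] = (fun w => (w, U w)) @^-1` (D `&` B)); last first.
  by apply/seteqP; split=> w /=; [move=> Bw; split=> //; exact: U0|case].
have FU V : measurable V -> F t (U @^-1` V).
  by move=> mV; apply: mU; exists V; rewrite ?setTI.
apply: (@check_gen_comap _ s).
- by apply: sF; exact/ltW/(le_lt_trans t0 ts).
- by move=> w; exact: U0.
- by [].
- move=> V mV; apply: (filtration_nondecreasing hF t0 (ltW ts)).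
  apply: (FU ((fun u => nmid u s%:E) @^-1` V)).
  by rewrite -[X in measurable X]setTI; exact: measurable_nmid.
- exact: cB.
Qed.

End filtration_facts.

(** * The progressively enlarged filtration: lifts, traces, completion *)

Section random_time_facts.
Context d (Om : measurableType d) (R : realType) (Q : probability Om R).
Context (F : R -> set (set Om)) (hF : filtration Q F).
Context (tau : Om -> \bar R) (htau : measurable_fun setT tau)
  (htau0 : forall w, (0 <= tau w)%E).
Local Notation D := (@prod_domain d Om R).

Let gen (s : R) : set (set Om) :=
  <<s F s `|` sigma_of (fun w => nmid (tau w) s%:E) >>.

Let sgen s : sigma_algebra setT (gen s). Proof. exact: smallest_sigma_algebra. Qed.

Let genF s B : F s B -> gen s B.
Proof. by move=> FB; apply: sub_sigma_algebra; left. Qed.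

Let gen_nmid s V : measurable V -> gen s ((fun w => nmid (tau w) s%:E) @^-1` V).
Proof. by move=> mV; apply: sub_sigma_algebra; right; exists V; rewrite ?setTI. Qed.

Lemma G0_filtration_sigma t : sigma_algebra setT (G0_filtration F tau t).
Proof. by apply: sigma_algebra_bigcap => s _; exact: sgen. Qed.

Lemma phi_check_G0 t B : check_G0_ext F t B -> G0_filtration F tau t (phi tau @^-1` B).
Proof.
move=> cB s /= ts; rewrite (_ : _ @^-1` B = phi tau @^-1` (D `&` B)); last first.
  by apply/seteqP; split=> w /=; [move=> Bw; split=> //; exact: htau0|case].
apply: (@check_gen_comap _ _ _ F _ s (phi tau) (gen s)) => //; last exact: cB.
- by move=> B' FB'; exact: genF.
- by move=> V mV; exact: gen_nmid.
Qed.

Lemma F_sub_G0 t B : 0 <= t -> F t B -> G0_filtration F tau t B.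
Proof.
by move=> t0 FB s /= ts; apply: genF; exact: (filtration_nondecreasing hF t0 (ltW ts)).
Qed.

Lemma check_G0_lt t : check_G0_ext F t [set x | (t%:E < x.2)%E].
Proof.
move=> s /= ts.
rewrite (_ : _ `&` _ = D `&` (fun x => nmid x.2 s%:E) @^-1` [set u | (t%:E < u)%E]).
  apply: check_gen_nmid; rewrite -set_itvoy; exact: emeasurable_itv.
apply/seteqP; split=> x /= [Dx]; rewrite /nmid => tx; split=> //.
  by move: tx; case: (leP x.2 s%:E) => // _ _; exact: ltry.
move: tx; case: (leP x.2 s%:E) => // sx.
by move=> _; apply: lt_trans sx; rewrite lte_fin.
Qed.

(** Each [s > t] provides a lift in [check_gen F s], but one that depends on [s]. [right_limit_set],
    with no localization ([E] constantly [setT]), merges these lifts into a single one lying in all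
    of them. *)
Lemma G0_lift t B : 0 <= t -> G0_filtration F tau t B ->
  exists2 C, check_G0_ext F t C & phi tau @^-1` C = B.
Proof.
move=> t0 GB.
pose H s := [set B : set (Om * \bar R) | check_gen F s (D `&` B)].
have [|||s ts|L HL LB] := @right_limit_set _ _ _ t H (phi tau) (fun=> setT) B.
- by move=> s ts; exact: sigma_algebra_ext (check_gen_sigma _ _).
- move=> s s' ts ss' C; apply: (check_gen_le hF) => //.
  exact/ltW/(le_lt_trans t0 ts).
- by [].
- have sH : sigma_algebra setT (H s) by exact: sigma_algebra_ext (check_gen_sigma _ _).
  have : preimage_set_system setT (phi tau) (H s) B.
    move: (GB s ts); apply: smallest_sub; first exact: sigma_algebra_preimage.
    move=> A [FA|[V mV <-]].
      exists (fst @^-1` A); first exact: check_genF.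
      by rewrite setTI.
    exists ((fun x => nmid x.2 s%:E) @^-1` V) => //.
    exact: check_gen_nmid.
  by move=> [C HC <-]; exists C; rewrite ?setTI.
exists L; first by move=> s; exact: HL.
by apply/seteqP; split=> w /=; have := LB (t + 1) w; rewrite ltrDl ltr01 => /(_ isT I) [].
Qed.

(** The comparison with [F s] is possible only on {s < tau}, for [s > t]. These events increase to
    {t < tau} as [s] decreases to [t], so [right_limit_set] yields one set valid on all of {t <
    tau}, and right-continuity places it in [F t]. *)
Lemma G0_trace t B : 0 <= t -> G0_filtration F tau t B ->
  exists2 C, F t C & forall w, (t%:E < tau w)%E -> (C w <-> B w).
Proof.
move=> t0 GB.
have s0 s : t < s -> 0 <= s by move=> /(le_lt_trans t0)/ltW.
pose E (s : R) := [set w | (s%:E < tau w)%E].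
have [|||s ts|L HL LB] := @right_limit_set _ _ _ t F id E B.
- by move=> s /s0; exact: filtration_sigma_algebra hF _.
- by move=> s s' /s0 s00; exact: filtration_nondecreasing hF _ _ _.
- by move=> s s' ts ss' w /=; apply: le_lt_trans; rewrite lee_fin.
- have sF := filtration_sigma_algebra hF (s0 _ ts); have [F0 FD FU] := sF.
  suff : [set B | exists2 C, F s C & E s `&` C = E s `&` B] B by [].
  move: (GB s ts); apply: smallest_sub.
    split.
    + by exists set0; rewrite // !setI0.
    + move=> A [C FC CA]; exists (setT `\` C); first exact: FD.
      have CAw w : E s w -> C w <-> A w.
        by move=> sw; have := congr1 (@^~ w) CA; rewrite /setI /mkset => e;
           split=> ?; [have: E s w /\ C w by []|have: E s w /\ A w by []];
           [rewrite e|rewrite -e] => -[].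
      by apply/seteqP; split=> w [sw [_ nw]]; split=> //; split=> // /(CAw w sw).
    + move=> A /(_ _)/cid2-/all_sig2[C FC CA].
      exists (\bigcup_k C k); first exact: FU.
      by rewrite !setI_bigcupr; apply: eq_bigcupr => k _; exact: CA.
  move=> A [FA|[V mV <-]]; first by exists A.
  (* On {s < tau} the variable [nmid (tau w) s%:E] is constantly [+oo], so its events have trivial
     trace there. *)
  have [Voo|Voo] := pselect (V +oo%E).
    exists setT; first by rewrite -(setD0 setT); exact: FD.
    apply/seteqP; split=> w /= [sw _]; split=> //; split=> //=.
    by rewrite /nmid leNgt sw.
  exists set0 => //; rewrite setI0; apply/seteqP; split=> w //= [sw [_]].
  by rewrite /nmid leNgt sw.
exists L; first exact: (filtration_bigcap hF t0 HL).
move=> w tw; have [s ts sw] : exists2 s, t < s & (s%:E < tau w)%E.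
  case: (tau w) tw => [u| |] //; last by exists (t + 1); rewrite ?ltrDl ?ltry.
  by rewrite lte_fin => tu; exists ((t + u) / 2); rewrite ?lte_fin ?midf_lt.
exact: (LB s w).
Qed.

Lemma G0_sub_measurable t : 0 <= t -> G0_filtration F tau t `<=` measurable.
Proof.
move=> t0 B /(_ (t + 1)) /=; rewrite ltrDl ltr01 => /(_ isT).
apply: smallest_sub; first exact: sigma_algebra_measurable.
move=> A [FA|[V mV <-]].
  by apply: (filtration_measurable hF) FA; rewrite addr_ge0.
by apply: (measurableT_comp (@measurable_nmid R (t + 1)) htau).
Qed.

Lemma G_filtration_sigma t : sigma_algebra setT (G_filtration Q F tau t).
Proof. exact: smallest_sigma_algebra. Qed.

Lemma G_sub_measurable t : 0 <= t -> G_filtration Q F tau t `<=` measurable.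
Proof.
move=> t0; apply: smallest_sub; first exact: sigma_algebra_measurable.
by move=> B [/(G0_sub_measurable t0)|[]].
Qed.

Lemma G0_sub_G t : G0_filtration F tau t `<=` G_filtration Q F tau t.
Proof. by move=> B GB; apply: sub_sigma_algebra; left. Qed.

(** The sets almost surely equal to a set of G^0_t form a sigma-algebra, and it contains the added
    null sets, which are equivalent to [set0]. *)
Lemma G_ae_G0 t B : 0 <= t -> G_filtration Q F tau t B ->
  exists2 B0, G0_filtration F tau t B0 & {ae Q, forall w, B w <-> B0 w}.
Proof.
move=> t0 GB; have [G0 GD GU] := G0_filtration_sigma t.
suff : [set B | exists2 B0, G0_filtration F tau t B0 & {ae Q, forall w, B w <-> B0 w}] B by [].
move: GB; apply: smallest_sub.
  split.
  - by exists set0 => //; apply: aeW.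
  - move=> A [C GC AC]; exists (setT `\` C); first exact: GD.
    by apply: filterS AC => w [AC CA]; split=> -[_ n]; split=> // ?; apply: n; [exact: CA|exact: AC].
  - move=> A /(_ _)/cid2-/all_sig2[C GC AC].
    exists (\bigcup_k C k); first exact: GU.
    have /ae_foralln : forall k, {ae Q, forall w, A k w <-> C k w} by [].
    by apply: filterS => w AC' ; split=> -[k _ /AC']; exists k.
move=> B' [GB|[mN [N [HN N0 BN]]]]; first by exists B' => //; apply: aeW.
exists set0 => //; exists N; split => //; last by move=> w /= n; apply: BN; apply: contrapT => ?; exact: n.
move: HN; apply: smallest_sub; first exact: sigma_algebra_measurable.
by move=> _ [/(F_infty_measurable hF)//|[V mV <-]]; exact: htau.
Qed.

End random_time_facts.
(** * The Cox measure *)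

Section cox.
Context d (Om : measurableType d) (R : realType) (Q : probability Om R).
Context (F : R -> set (set Om)) (hF : filtration Q F).
Context (A : Om -> cumulative R R) (pA : predictable F (fun t w => A w t))
  (A0 : forall w (t : R), t < 0 -> A w t = 0).
Local Notation D := (@prod_domain d Om R).
Local Notation RR := (measurableTypeR R).

Definition cox_map (x : Om * R) : Om * \bar R := (x.1, quantile (A x.1) x.2).

Lemma cox_map_domain x : D (cox_map x).
Proof. exact: quantile_ge0. Qed.

Lemma measurable_A u : 0 <= u -> measurable_fun setT (fun w => A w u).
Proof.
move=> u0 _ B mB; apply: (filtration_measurable hF u0).
by apply: (predictable_adapted hF pA u0); exists B.
Qed.

Lemma measurable_cox_map : measurable_fun setT (cox_map : Om * RR -> Om * \bar R).
Proof.
apply/measurable_fun_pairP; split; first exact: measurable_fst.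
apply: (@measurable_quantile _ _ _ (fun x : Om * RR => A x.1) (fun x => x.2)).
  by move=> u u0; exact: (measurableT_comp (measurable_A u0) measurable_fst).
exact: measurable_snd.
Qed.

Lemma quantile_adapted (r u : R) : 0 <= u -> F u [set w | (quantile (A w) r <= u%:E)%E].
Proof.
move=> u0; have := predictable_adapted hF pA u0.
move=> /(_ (setT `&` (A ^~ u) @^-1` `[r, +oo[%classic)).
rewrite (_ : [set w | _] = setT `&` (A ^~ u) @^-1` `[r, +oo[%classic).
  by apply; exists `[r, +oo[%classic => //; exact: measurable_itv.
by apply/seteqP; split=> w /=; rewrite quantile_le u0 in_itv/= andbT //; case.
Qed.

(** Vanishing of [h] at [+oo] removes at once the atom of the Cox measure at infinity and the levels
    that are never reached. Restricting [h] to [D] lets the integral over non-negative times be read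
    as one over the whole line. *)
Lemma cox_expectationE (h : Om * \bar R -> \bar R) :
  measurable_fun setT (h \_ D) -> (forall x, D x -> (0 <= h x)%E) ->
  (forall w, h (w, +oo%E) = 0%E) ->
  cox_expectation Q A h =
  (\int[Q \x lebesgue_measure]_x (h (cox_map x) * (\1_[set s : R | 0 < s] x.2)%:E))%E.
Proof.
move=> mh h0 hoo.
have hD0 x : (0 <= (h \_ D) x)%E by rewrite patchE; case: ifPn => // /set_mem /h0.
pose k (x : Om * RR) : \bar R := ((h \_ D) (cox_map x) * (\1_[set s : R | 0 < s] x.2)%:E)%E.
have mpos : measurable [set s : R | 0 < s].
  rewrite (_ : [set s | _] = `]0, +oo[%classic); first exact: measurable_itv.
  by apply/seteqP; split=> x /=; rewrite in_itv/= andbT.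
have mk : measurable_fun setT k.
  apply: emeasurable_funM; first exact: (measurableT_comp mh measurable_cox_map).
  apply/measurable_EFinP.
  exact: (measurableT_comp (measurable_indic mpos) measurable_snd).
have k0 x : (0 <= k x)%E by rewrite mule_ge0// lee_fin indicE; case: (_ \in _).
transitivity (\int[Q \x lebesgue_measure]_x k x)%E; last first.
  apply: eq_integral => x _; rewrite /k patchE mem_set//; exact: cox_map_domain.
rewrite fubini_tonelli1//; apply: eq_integral => w _.
rewrite /integral_dA hoo mule0 mul0e adde0.
have := @integral_stieltjes_quantile R (A w) (fun v => (h \_ D) (w, v)) (A0 w).
rewrite /fubini_F /k /cox_map /= => <- //; last 2 first.
- exact: (measurableT_comp mh (pair1_measurable w)).
- by rewrite patchE; case: ifP.
rewrite integral_mkcond; apply: eq_integral => v _.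
rewrite !patchE; have [v0|v0] := leP 0 v.
  by rewrite !mem_set//= in_itv/= andbT.
rewrite !memNset//=; first by rewrite /prod_domain /= lee_fin leNgt v0.
by move=> []; rewrite in_itv/= leNgt v0.
Qed.

End cox.

(** * The law of (w, tau) on {u <= s} in level coordinates *)

Section density.
Context d (Om : measurableType d) (R : realType) (Q : probability Om R).
Context (F : R -> set (set Om)) (hF : filtration Q F).
Context (tau : Om -> \bar R) (htau : measurable_fun setT tau)
  (htau0 : forall w, (0 <= tau w)%E).
Context (A : Om -> cumulative R R) (pA : predictable F (fun t w => A w t))
  (A0 : forall w (t : R), t < 0 -> A w t = 0).
Context (Z : R -> Om -> R) (iM : \bar R -> R -> Om -> R) (T : \bar R)
  (p : R -> Om * \bar R -> R) (hp : regularized_density Q F tau Z A iM T p).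
Local Notation D := (@prod_domain d Om R).
Local Notation RR := (measurableTypeR R).
Local Notation Psi := (cox_map A).
Local Notation QL := (Q \x (@lebesgue_measure R))%E.

Definition below (s : R) : set (Om * \bar R) := [set x | (x.2 <= s%:E)%E].

Definition positive_level (x : Om * R) : R := \1_[set r : R | 0 < r] x.2.

(** The density against Q x Lebesgue whose image under [Psi] is the law of (w, tau) restricted to {u
    <= s}. *)
Definition cox_weight (s : R) (x : Om * R) : R :=
  positive_level x * (\1_(below s) (Psi x) * p s (Psi x)).

Lemma positive_level_ge0 x : 0 <= positive_level x.
Proof. by rewrite /positive_level indicE; case: (_ \in _). Qed.

Lemma measurable_positive_level : measurable_fun setT (positive_level : Om * RR -> R).
Proof.
have mpos : measurable [set s : R | 0 < s].
  rewrite (_ : [set s | _] = `]0, +oo[%classic); first exact: measurable_itv.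
  by apply/seteqP; split=> x /=; rewrite in_itv/= andbT.
exact: (measurableT_comp (measurable_indic mpos) measurable_snd).
Qed.

Lemma check_G0_below (s t : R) : s <= t -> check_G0_ext F t (below s).
Proof.
move=> st; rewrite (_ : below s = setT `\` [set x | (s%:E < x.2)%E]); last first.
  apply/seteqP; split=> x; rewrite /below /=; first by move=> xs; split=> //; rewrite ltNge xs.
  by move=> [_ /negP]; rewrite -leNgt.
have [_ + _] := check_G0_ext_sigma F t; apply.
by apply: (check_G0_le st); exact: check_G0_lt.
Qed.

Lemma measurable_Psi s : 0 <= s ->
  measurable_fun setT (Psi : Om * RR -> g_sigma_algebraType (check_G0_ext F s)).
Proof.
move=> s0; apply: (measurable_to_check_G0 hF s0).
  exact: (measurable_cox_map hF pA).
exact: cox_map_domain.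
Qed.

Lemma measurable_phi s : 0 <= s ->
  measurable_fun setT (phi tau : Om -> g_sigma_algebraType (check_G0_ext F s)).
Proof.
move=> s0; apply: (measurable_to_check_G0 hF s0) => //.
by apply/measurable_fun_pairP; split; [exact: measurable_id|exact: htau].
Qed.

Lemma cG0_measurable s B : check_G0_ext F s B ->
  measurable (B : set (g_sigma_algebraType (check_G0_ext F s))).
Proof. by rewrite measurable_g_measurableTypeE//; exact: check_G0_ext_sigma. Qed.

Lemma measurable_fun_prod_domain s d' (Y : measurableType d') (k : Om * \bar R -> Y) :
  0 <= s ->
  measurable_fun (setT : set (g_sigma_algebraType (check_G0_ext F s))) k ->
  measurable_fun D (k : Om * \bar R -> Y).
Proof.
move=> s0 mk _ V mV; apply: (check_G0_ext_measurable hF s0).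
have := mk measurableT V mV; rewrite setTI measurable_g_measurableTypeE//.
exact: check_G0_ext_sigma.
Qed.

Lemma measurable_prod_domain : measurable D.
Proof.
by rewrite -prod_domainE; apply: measurableX => //; rewrite -set_itvcy; exact: emeasurable_itv.
Qed.

Lemma measurable_cox_weight s : 0 <= s -> (s%:E < T)%E ->
  measurable_fun setT (cox_weight s : Om * RR -> R).
Proof.
move=> s0 sT; apply: measurable_funM; first exact: measurable_positive_level.
pose k : g_sigma_algebraType (check_G0_ext F s) -> R := fun x => \1_(below s) x * p s x.
have mk : measurable_fun setT k.
  apply: measurable_funM.
    by apply: measurable_indic; apply: cG0_measurable; exact: check_G0_below.
  by apply/measurable_check_G0P; exact: (density_adapted hp s0 sT).
exact: (measurableT_comp mk (measurable_Psi s0)).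
Qed.

Lemma cox_weight_ge0 s x : 0 <= s -> (s%:E < T)%E -> 0 <= cox_weight s x.
Proof.
move=> s0 sT; apply: mulr_ge0; first exact: positive_level_ge0.
apply: mulr_ge0; first by rewrite indicE; case: (_ \in _).
by apply: (density_ge0 hp) => //; exact: cox_map_domain.
Qed.

(** On {u <= s} the term Z / (1 - A) of the density process drops out and only [p s] remains. The
    point at infinity is excluded as well, as [cox_expectationE] requires. *)
Lemma density_check_G0 s B : 0 <= s -> (s%:E < T)%E -> check_G0_ext F s B ->
  Q (phi tau @^-1` (B `&` below s)) =
  (\int[QL]_(x in Psi @^-1` B) (cox_weight s x)%:E)%E.
Proof.
move=> s0 sT cB.
pose B' := D `&` B `&` below s.
have cB' : check_G0 F s B'.
  rewrite /B' -setIA.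
  have sE := check_G0_ext_sigma F s.
  by have := sigma_algebra_setI sE (@subsetT _ B) cB (check_G0_below (lexx s)).
have -> : phi tau @^-1` (B `&` below s) = phi tau @^-1` B'.
  by apply/seteqP; split=> w; [move=> [? ?]; split=> //; split=> //; exact: htau0|move=> [[? ?] ?]].
have := density_RN hp s0 sT cB'; rewrite /check_Q /pushforward => ->.
pose k x := ((\1_B' x * p s x)%:E : \bar R).
have kE x : (\1_B' x * density_process Z A p s x)%:E = k x.
  rewrite /k /density_process; congr EFin.
  rewrite indicE; case: (boolP (x \in B')); last by rewrite !mul0r.
  rewrite inE => -[[_ _] xs]; rewrite !indicE memNset ?mul0r ?add0r.
    by rewrite [x \in _]mem_set// !mul1r.
  by rewrite /= ltNge; apply/negP; rewrite negbK.
under [in LHS]eq_fun do rewrite kE.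
rewrite (cox_expectationE hF pA A0)//.
- rewrite [RHS]integral_mkcond; apply: eq_integral => x _; rewrite patchE /k.
  rewrite /cox_weight -/(positive_level x).
  have DP := cox_map_domain A x.
  case: ifPn => xB.
    have -> : \1_B' (Psi x) = \1_(below s) (Psi x) :> R.
      rewrite !indicE; congr (_%:R); congr nat_of_bool; apply/idP/idP.
        by rewrite !inE => -[].
      by rewrite !inE => ?; split=> //; split=> //; move: xB; rewrite inE.
    by rewrite -EFinM mulrC.
  rewrite indicE memNset ?mul0r ?mul0e// => -[[_ Bx] _].
  by move/negP: xB; apply; rewrite inE.
- apply/(measurable_restrictT _ measurable_prod_domain).
  apply: (measurable_fun_prod_domain s0); apply/measurable_EFinP/measurable_funM.
    by apply: measurable_indic; apply: cG0_measurable; rewrite /check_G0_ext /= setIidr // => x [[]].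
  by apply/measurable_check_G0P; exact: (density_adapted hp s0 sT).
- move=> x Dx; rewrite /k lee_fin; apply: mulr_ge0; last exact: (density_ge0 hp).
  by rewrite indicE; case: (_ \in _).
- by move=> w; rewrite /k indicE memNset ?mul0r// => -[_]; rewrite /below /= leye_eq.
Qed.

Lemma integral_density s (k : Om * \bar R -> \bar R) : 0 <= s -> (s%:E < T)%E ->
  measurable_fun (setT : set (g_sigma_algebraType (check_G0_ext F s))) k ->
  (forall x, 0 <= k x)%E ->
  (\int[Q]_w (k (phi tau w) * (\1_(below s) (phi tau w))%:E) =
   \int[QL]_x (k (Psi x) * (cox_weight s x)%:E))%E.
Proof.
move=> s0 sT mk k0.
pose Y := g_sigma_algebraType (check_G0_ext F s).
have mb : measurable (below s : set Y).
  by apply: cG0_measurable; exact: check_G0_below.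
apply: (@ge0_integral_transfer _ _ _ Om (Om * RR)%type Y R Q QL (phi tau) Psi
  (\1_(below s) \o phi tau) (cox_weight s)) => //.
- exact: measurable_phi.
- exact: measurable_Psi.
- exact: (measurableT_comp (measurable_indic mb) (measurable_phi s0)).
- exact: measurable_cox_weight.
- by move=> x; exact: cox_weight_ge0.
move=> B mB; rewrite -density_check_G0//; last first.
  by move: mB; rewrite measurable_g_measurableTypeE//; exact: check_G0_ext_sigma.
have mphi C : measurable (C : set Y) -> measurable (phi tau @^-1` C).
  by move=> mC; rewrite -[X in measurable X]setTI; exact: (measurable_phi s0).
rewrite preimage_setI setIC -integral_indic//; exact: mphi.
Qed.

End density.

(** * The parametrized projection along quantile times *)

Section projection.
Context d (Om : measurableType d) (R : realType) (Q : probability Om R).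
Context (F : R -> set (set Om)) (hF : filtration Q F).
Context (A : Om -> cumulative R R) (pA : predictable F (fun t w => A w t)).
Context (H : Om * \bar R -> \bar R) (oH : R -> Om * \bar R -> \bar R)
  (hoH : param_optional_projection Q F H oH).
Context (t : R) (t0 : 0 <= t).
Local Notation D := (@prod_domain d Om R).
Local Notation RR := (measurableTypeR R).
Local Notation Psi := (cox_map A).
Local Notation QL := (Q \x (@lebesgue_measure R))%E.
Local Notation Y := (g_sigma_algebraType (check_G0_ext F t)).

Let sF : sigma_algebra setT (F t). Proof. exact: filtration_sigma_algebra hF _ t0. Qed.

(** The cap makes the quantile [F t]-measurable and bounded by t everywhere; the sets of interest
    lie in {C_r <= t}, where it changes nothing. *)
Definition quantile_time (r : R) (w : Om) : \bar R := mine (quantile (A w) r) t%:E.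

(** The index [Num.min u t] is used in two ways: bounded by [u] it gives a stopping time, bounded by
    [t] it gives [F t]-measurability. *)
Lemma quantile_time_le r u : 0 <= u ->
  F (Num.min u t) [set w | (quantile_time r w <= u%:E)%E].
Proof.
move=> u0; rewrite /quantile_time; have [ut|tu] := ltP u t.
  rewrite (_ : [set _ | _] = [set w | (quantile (A w) r <= u%:E)%E]).
    exact: (quantile_adapted hF pA).
  by apply/seteqP; split=> w /=; rewrite ge_min lee_fin (leNgt t) ut orbF.
rewrite (_ : [set _ | _] = setT); first by have [F0 FD _] := sF; rewrite -(setD0 setT); exact: FD.
by apply/seteqP; split=> w //= _; rewrite ge_min lee_fin tu orbT.
Qed.

Lemma stopping_time_quantile_time r : stopping_time F (quantile_time r).
Proof.
split=> [w|u u0]; first by rewrite /quantile_time le_min quantile_ge0 lee_fin.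
have := quantile_time_le r u0; apply: (filtration_nondecreasing hF).
  by rewrite le_min u0.
by rewrite ge_min lexx.
Qed.

Lemma quantile_time_measurable r : measurable_wrt setT (F t) (quantile_time r).
Proof.
apply/(measurable_wrtP sF); apply: measurable_fun_le_set => u.
rewrite measurable_g_measurableTypeE//; have [u0|u0] := leP 0 u.
  have := quantile_time_le r u0; apply: (filtration_nondecreasing hF).
    by rewrite le_min u0.
  by rewrite ge_min lexx orbT.
rewrite (_ : [set _ | _] = set0); first by case: sF.
apply/seteqP; split=> w //=; rewrite /quantile_time ge_min !lee_fin leNgt.
rewrite (lt_le_trans _ (quantile_ge0 _ _)) ?lte_fin//= leNgt.
by rewrite (lt_le_trans u0 t0).
Qed.

Lemma quantile_slice r B : check_G0_ext F t B ->
  F t [set w | B (w, quantile_time r w) /\ (quantile (A w) r <= t%:E)%E].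
Proof.
move=> cB.
apply: (@sigma_algebra_setI _ setT (F t) [set w | B (w, quantile_time r w)]
  [set w | (quantile (A w) r <= t%:E)%E] sF (@subsetT _ _)).
  have U0 : forall w, (0 <= quantile_time r w)%E by case: (stopping_time_quantile_time r).
  exact: (check_G0_section hF t0 (@quantile_time_measurable r) U0 cB).
exact: (quantile_adapted hF pA).
Qed.

Lemma integral_quantile_slice r B : check_G0_ext F t B ->
  let Br := [set w | B (w, quantile_time r w) /\ (quantile (A w) r <= t%:E)%E] in
  (\int[Q]_(w in Br) H (w, quantile_time r w) =
   \int[Q]_(w in Br) oH t (w, quantile_time r w))%E.
Proof.
move=> cB Br; have FBr : F t Br by exact: quantile_slice.
apply: (@pop_stopping _ _ _ _ _ _ _ hoH (quantile_time r) (fun=> t%:E)).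
- exact: stopping_time_quantile_time.
- split=> [w|u u0]; first by rewrite lee_fin.
  have [Fu0 FuD _] := filtration_sigma_algebra hF u0.
  have [tu|ut] := leP t u.
    rewrite (_ : [set _ | _] = setT `\` set0); first exact: FuD.
    by rewrite setD0; apply/seteqP; split=> w //= _; rewrite lee_fin.
  by rewrite (_ : [set _ | _] = set0)//; apply/seteqP; split=> w //=; rewrite lee_fin leNgt ut.
- by move=> w; rewrite /quantile_time ge_min lexx orbT.
- split; first exact: (F_sub_F_infty t0).
  move=> u u0; have [tu|ut] := leP t u.
    rewrite (_ : _ `&` _ = Br); first exact: (filtration_nondecreasing hF t0 tu).
    by apply/setIidPl => w _ /=; rewrite lee_fin.
  rewrite (_ : _ `&` _ = set0); first by case: (filtration_sigma_algebra hF u0).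
  by apply/seteqP; split=> w //= [_]; rewrite lee_fin leNgt ut.
- by move=> w _ /=; exact: ltry.
Qed.

(** The cut at {u <= t} is where joint measurability for [F t] and the Borel sets becomes
    measurability for [check_G0 F t]: beyond t, the latter does not see the value of u. *)
Definition projection_below : Om * \bar R -> \bar R := oH t \_ (@below d Om R t).

Lemma measurable_projection_below : measurable_fun (setT : set Y) projection_below.
Proof.
have sY := check_G0_ext_sigma F t.
have mb : measurable (below t : set Y).
  by apply: cG0_measurable; exact: check_G0_below.
apply/(measurable_restrictT _ mb) => _ V mV.
rewrite measurable_g_measurableTypeE//.
have := @pop_section_measurable _ _ _ _ _ hF _ t t0 (pop_measurable hoH).
move=> /(_ _ (ex_intro2 _ _ V mV erefl)) /(prod_borel_check_G0 hF t0).
rewrite /check_G0_ext /=; congr (check_G0 F t _).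
by apply/seteqP; split=> -[w u] /=; rewrite /below /=; [move=> [[? ?] [? ?]]|move=> [? [? ?]]].
Qed.

Hypothesis H0 : forall x, D x -> (0 <= H x)%E.
Hypothesis mH : measurable_fun setT (H \o Psi : Om * RR -> \bar R).

Lemma measurable_slice B : check_G0_ext F t B ->
  measurable_fun setT ((fun x => (positive_level x * \1_(B `&` below t) (Psi x))%:E) :
     Om * RR -> \bar R).
Proof.
move=> cB; apply/measurable_EFinP/measurable_funM; first exact: measurable_positive_level.
have mB : measurable (B `&` below t : set Y).
  by apply: measurableI; apply: cG0_measurable => //; exact: check_G0_below.
exact: (measurableT_comp (measurable_indic mB) (measurable_Psi hF pA t0)).
Qed.

(* A slice of the Cox measure at level r is carried by the graph of the stopping
   time [quantile (A w) r], so that property (iii) of the projection applies to it. *)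
Lemma integral_slice (K : Om * \bar R -> \bar R) B r :
  check_G0_ext F t B ->
  (\int[Q]_w ((positive_level (w, r) * \1_(B `&` below t) (Psi (w, r)))%:E * K (Psi (w, r))) =
   (\1_[set s : R | (0 < s)%R] r)%:E *
    \int[Q]_(w in [set w | B (w, quantile_time r w) /\ (quantile (A w) r <= t%:E)%E])
      K (w, quantile_time r w))%E.
Proof.
move=> cB; set Br := [set w | B _ /\ _].
have bE w : ((\1_(B `&` below t) (Psi (w, r)))%:E * K (Psi (w, r)) =
    ((fun w => K (w, quantile_time r w)) \_ Br) w)%E.
  rewrite patchE indicE; case: ifPn => [|nBr].
    rewrite inE => -[Bw qt]; have qE : quantile_time r w = quantile (A w) r.
      by rewrite /quantile_time; apply/min_idPl.
    by rewrite mem_set ?mul1e /cox_map/= ?qE//; split=> //; rewrite -qE.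
  rewrite memNset ?mul0e// => -[BP bP]; move/negP: nBr; apply; rewrite inE.
  have qE : quantile_time r w = quantile (A w) r.
    by rewrite /quantile_time; apply/min_idPl.
  by split => //; rewrite qE.
rewrite /positive_level /=; have [r0|r0] := pselect (0 < r).
  rewrite indicE mem_set// mul1e [RHS]integral_mkcond; apply: eq_integral => w _.
  by rewrite mul1r bE.
rewrite indicE memNset// mul0e; under eq_integral do rewrite mul0r mul0e.
by rewrite integral0.
Qed.

(** The sign condition on [B] is there for Tonelli, since the projection itself may be negative; [B]
    will be chosen inside the set where it is not. *)
Lemma integral_projection B : check_G0_ext F t B ->
  (forall x, B x -> 0 <= projection_below x)%E ->
  (\int[QL]_x ((positive_level x * \1_(B `&` below t) (Psi x))%:E * H (Psi x)) =
   \int[QL]_x ((positive_level x * \1_(B `&` below t) (Psi x))%:E *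
      projection_below (Psi x)))%E.
Proof.
move=> cB B0.
have c0 x : (0 <= (positive_level x * \1_(B `&` below t) (Psi x))%:E)%E.
  by rewrite lee_fin mulr_ge0 ?positive_level_ge0// indicE; case: (_ \in _).
rewrite !fubini_tonelli2//.
(* The order of integration is the point: at a fixed level, the inner integral over [Om] runs along
   the graph of one stopping time. *)
- apply: eq_integral => r _; rewrite /fubini_G !integral_slice//.
  congr (_ * _)%E; rewrite integral_quantile_slice//.
  apply: eq_integral => w; rewrite inE => -[_ qt].
  by rewrite /projection_below patchE mem_set// /below /= /quantile_time ge_min qt.
- apply: emeasurable_funM; first exact: measurable_slice.
  exact: (measurableT_comp measurable_projection_below (measurable_Psi hF pA t0)).
- move=> x; rewrite /= indicE; case: (boolP (_ \in _)) => [|_]; last by rewrite mulr0 mul0e.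
  by rewrite inE => -[/B0 ? _]; rewrite mule_ge0// lee_fin mulr1 positive_level_ge0.
- by apply: emeasurable_funM; first exact: measurable_slice.
- by move=> x; rewrite mule_ge0// H0//; exact: cox_map_domain.
Qed.

(** Level by level: over the slice of [N] the projection is negative, yet its integral equals that
    of [H], which is non-negative; so each slice is null. The factor [K] leaves room for the density
    [p t]. *)
Lemma projection_below_ge0_cox :
  let N := [set x | (projection_below x < 0)%E] in
  forall K : Om * \bar R -> \bar R,
  measurable_fun setT (K \o Psi : Om * RR -> \bar R) ->
  (forall x, D x -> 0 <= K x)%E ->
  (\int[QL]_x ((positive_level x * \1_(N `&` below t) (Psi x))%:E * K (Psi x)) = 0)%E.
Proof.
move=> N K mK K0.
have cN : check_G0_ext F t N.
  have := @emeasurable_fun_infty_o _ _ _ setT _ measurableT measurable_projection_below 0%E.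
  rewrite setTI measurable_g_measurableTypeE//; exact: check_G0_ext_sigma.
have c0 x : (0 <= (positive_level x * \1_(N `&` below t) (Psi x))%:E)%E.
  by rewrite lee_fin mulr_ge0 ?positive_level_ge0// indicE; case: (_ \in _).
rewrite fubini_tonelli2//; last 2 first.
- by apply: emeasurable_funM; first exact: measurable_slice.
- by move=> x; rewrite mule_ge0// K0//; exact: cox_map_domain.
rewrite integral0_eq// => r _; rewrite /fubini_G integral_slice//.
set Nr := [set w | N _ /\ _].
have mNr : measurable Nr by apply: (filtration_measurable hF t0); exact: quantile_slice.
have mU : measurable_fun setT (fun w => (w, quantile_time r w)).
  apply/measurable_fun_pairP; split; first exact: measurable_id.
  move=> _ V mV; apply: (filtration_measurable hF t0).
  by apply: quantile_time_measurable; exists V.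
have UD w : D (w, quantile_time r w).
  by case: (stopping_time_quantile_time r) => + _; exact.
have QN0 : Q Nr = 0%E.
  apply: (@measure0_integral_neg _ _ _ _ _ (fun w => projection_below (w, quantile_time r w))) => //.
  - apply: measurable_funTS.
    exact: (measurableT_comp measurable_projection_below (measurable_to_check_G0 hF t0 mU UD)).
  - by move=> w [].
  - rewrite (eq_integral (fun w => oH t (w, quantile_time r w))); last first.
      move=> w; rewrite inE => -[_ qt].
      by rewrite /projection_below patchE mem_set// /below /= /quantile_time ge_min qt.
    by rewrite -integral_quantile_slice//; apply: integral_ge0 => w _; exact: H0.
rewrite (eq_integral (fun w => K (Psi (w, r)))); last first.
  move=> w; rewrite inE => -[_ qt]; congr (K (_, _)).
  by rewrite /quantile_time; apply/min_idPl.
rewrite null_set_integral ?mule0//; apply: measurable_funTS.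
exact: (measurableT_comp mK (pair2_measurable (r : RR))).
Qed.

End projection.
Lemma measurable_inv (R : realType) : measurable_fun [set: R] (fun r : R => r^-1).
Proof.
have -> : [set: R] = [set r | r != 0] `|` [set 0].
  apply/seteqP; split=> r //= _; have [->|r0] := eqVneq r 0; first by right.
  by left.
have o0 : open [set r : R | r != 0] by exact: open_neq.
apply/measurable_funU => //; first exact: open_measurable.
split; last exact: measurable_fun_set1.
apply: open_continuous_measurable_fun => // r; rewrite inE /= => r0.
exact: inv_continuous.
Qed.

(** * The conditional expectation on {tau <= t} *)

Section after_default.
Context d (Om : measurableType d) (R : realType) (Q : probability Om R).
Context (F : R -> set (set Om)) (hF : filtration Q F).
Context (tau : Om -> \bar R) (htau : measurable_fun setT tau)
  (htau0 : forall w, (0 <= tau w)%E).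
Context (A : Om -> cumulative R R) (pA : predictable F (fun t w => A w t))
  (A0 : forall w (t : R), t < 0 -> A w t = 0).
Context (Z : R -> Om -> R) (iM : \bar R -> R -> Om -> R) (T : \bar R)
  (p : R -> Om * \bar R -> R) (hp : regularized_density Q F tau Z A iM T p).
Context (t b : R) (t0 : 0 <= t) (tb : t <= b) (bT : (b%:E < T)%E).
Context (f : Om * \bar R -> \bar R)
  (hf : measurable_wrt (@prod_domain d Om R) (check_G0 F b) f)
  (hf0 : forall x, prod_domain x -> (0 <= f x)%E).
Context (ofp : R -> Om * \bar R -> \bar R)
  (hofp : param_optional_projection Q F (fun x => f x * (p b x)%:E)%E ofp).
Local Notation D := (@prod_domain d Om R).
Local Notation RR := (measurableTypeR R).
Local Notation Psi := (cox_map A).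
Local Notation QL := (Q \x (@lebesgue_measure R))%E.
Local Notation Y s := (g_sigma_algebraType (check_G0_ext F s)).
Local Notation g := (projection_below ofp t).
Local Notation bel := (@below d Om R t).

Let b0 : 0 <= b. Proof. exact: le_trans tb. Qed.
Let tT : (t%:E < T)%E. Proof. by apply: le_lt_trans bT; rewrite lee_fin. Qed.

Let YE s B : measurable (B : set (Y s)) -> check_G0_ext F s B.
Proof. by rewrite measurable_g_measurableTypeE//; exact: check_G0_ext_sigma. Qed.

Let mg : measurable_fun (setT : set (Y t)) g.
Proof. exact: (measurable_projection_below hF hofp t0). Qed.

Let mp : measurable_fun (setT : set (Y t)) (p t).
Proof. by apply/measurable_check_G0P; exact: (density_adapted hp t0 tT). Qed.

(** The guards make the quotient non-negative everywhere; within {u <= t} they alter it only on sets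
    that are null for the law of (w, tau). *)
Definition after_default_value (x : Om * \bar R) : \bar R :=
  if (0 < p t x) && (0 <= g x)%E then (g x * ((p t x)^-1)%:E)%E else 0%E.

Local Notation V := after_default_value.

Definition regular_set : set (Om * \bar R) := [set x | 0 < p t x /\ (0 <= g x)%E].

Let mgood : measurable (regular_set : set (Y t)).
Proof.
rewrite (_ : regular_set = p t @^-1` `]0, +oo[%classic `&` [set x | (0 <= g x)%E]).
  apply: measurableI.
    by rewrite -[X in measurable X]setTI; apply: mp => //; exact: measurable_itv.
  have := @emeasurable_fun_c_infty _ _ _ setT _ measurableT mg 0%E.
  by rewrite setTI.
by apply/seteqP; split=> x /=; rewrite in_itv/= andbT.
Qed.

Lemma after_default_value_ge0 x : (0 <= V x)%E.
Proof.
rewrite /V; case: ifPn => // /andP[p0 g0].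
by rewrite mule_ge0// lee_fin invr_ge0 ltW.
Qed.

Lemma measurable_after_default_value : measurable_fun (setT : set (Y t)) V.
Proof.
rewrite (_ : V = (fun x => g x * ((p t x)^-1)%:E)%E \_ regular_set); last first.
  apply/funext => x; rewrite /V patchE; case: ifPn => [/andP[? ?]|n].
    by rewrite mem_set.
  by rewrite memNset// => -[? ?]; move/negP: n; apply; apply/andP.
apply/(measurable_restrictT _ mgood).
apply: emeasurable_funM; first exact: measurable_funTS.
apply/measurable_EFinP/measurable_funTS.
exact: (measurableT_comp (@measurable_inv R) mp).
Qed.

Let mbel s : t <= s -> measurable (bel : set (Y s)).
Proof. by move=> ts; apply: cG0_measurable; exact: check_G0_below. Qed.

Let mphi s B : 0 <= s -> measurable (B : set (Y s)) -> measurable (phi tau @^-1` B).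
Proof. by move=> s0 mB; rewrite -[X in measurable X]setTI; exact: (measurable_phi hF htau htau0 s0). Qed.

Let DP x : D (Psi x). Proof. exact: cox_map_domain. Qed.
Let Dphi w : D (phi tau w). Proof. exact: htau0. Qed.

Let mpneg : measurable ([set x | p t x <= 0] : set (Y t)).
Proof.
rewrite (_ : [set _ | _] = p t @^-1` `]-oo, 0]%classic).
  by rewrite -[X in measurable X]setTI; apply: mp => //; exact: measurable_itv.
by apply/seteqP; split=> x /=; rewrite in_itv.
Qed.

Let mgneg : measurable ([set x | (g x < 0)%E] : set (Y t)).
Proof.
have := @emeasurable_fun_infty_o _ _ _ setT _ measurableT mg 0%E.
by rewrite setTI.
Qed.

Lemma density_zero_negligible :
  Q (phi tau @^-1` ([set x | p t x <= 0] `&` bel)) = 0%E.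
Proof.
rewrite (density_check_G0 hF htau0 pA A0 hp t0 tT (YE mpneg)).
apply: integral0_eq => x /= px; rewrite /cox_weight.
suff -> : p t (Psi x) = 0 by rewrite !mulr0.
by apply/eqP; rewrite eq_le px (density_ge0 hp).
Qed.

Lemma projection_neg_negligible :
  Q (phi tau @^-1` ([set x | (g x < 0)%E] `&` bel)) = 0%E.
Proof.
rewrite (density_check_G0 hF htau0 pA A0 hp t0 tT (YE mgneg)).
have mK : measurable_fun setT ((EFin \o p t) \o Psi : Om * RR -> \bar R).
  by apply/measurable_EFinP; exact: (measurableT_comp mp (measurable_Psi hF pA t0)).
have K0 x : D x -> (0 <= (EFin \o p t) x)%E.
  by move=> Dx; rewrite lee_fin (density_ge0 hp).
have H0 x : D x -> (0 <= f x * (p b x)%:E)%E.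
  by move=> Dx; rewrite mule_ge0 ?hf0// lee_fin (density_ge0 hp).
rewrite -[RHS](projection_below_ge0_cox hF pA hofp t0 H0 mK K0).
rewrite [LHS]integral_mkcond; apply: eq_integral => x _.
rewrite patchE /cox_weight /=; case: ifPn => xN.
  rewrite -EFinM mulrA; congr ((_ * _ * _)%:E); rewrite !indicE; congr (_%:R).
  congr nat_of_bool; have gx := set_mem xN; apply/idP/idP; rewrite !inE => h.
    by split.
  by case: h.
rewrite indicE memNset ?mulr0 ?mul0e// => -[gx _].
by move/negP: xN; apply; rewrite inE.
Qed.

Lemma ae_projection_ge0 :
  {ae Q, forall w, (tau w <= t%:E)%E -> (0 <= g (phi tau w))%E}.
Proof.
exists (phi tau @^-1` ([set x | (g x < 0)%E] `&` bel)); split.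
- by apply: (mphi t0); apply: measurableI => //; exact: mbel.
- exact: projection_neg_negligible.
- by move=> w /= /not_implyP[tw /negP]; rewrite -ltNge.
Qed.

(** Applied to both sides of the identity to be proved, this moves the computation to a set where
    division by [p t] and Tonelli are legitimate. *)
Lemma integral_regular_set (k : Om * \bar R -> \bar R) B :
  measurable_fun setT (k \o phi tau) -> (forall w, 0 <= k (phi tau w))%E ->
  check_G0_ext F t B ->
  (\int[Q]_(w in phi tau @^-1` (B `&` bel)) k (phi tau w) =
   \int[Q]_(w in phi tau @^-1` (B `&` regular_set `&` bel)) k (phi tau w))%E.
Proof.
move=> mk k0 cB; have mB := cG0_measurable cB.
pose N1 := phi tau @^-1` ([set x | p t x <= 0] `&` bel).
pose N2 := phi tau @^-1` ([set x | (g x < 0)%E] `&` bel).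
have N12 : N1 `|` N2 = phi tau @^-1` (~` regular_set `&` bel).
  apply/seteqP; split=> w /=.
    move=> [[pw bw]|[gw bw]]; split=> // -[]; first by rewrite ltNge pw.
    by rewrite leNgt gw.
  move=> [ngood bw]; have [pw|pw] := leP (p t (phi tau w)) 0; first by left.
  by right; split=> //=; rewrite ltNge; apply/negP => gw; exact: ngood.
have mN : measurable (N1 `|` N2).
  by rewrite N12; apply: (mphi t0); apply: measurableI; [exact: measurableC|exact: mbel].
have QN : Q (N1 `|` N2) = 0%E.
  have mN1 : measurable N1 by apply: (mphi t0); apply: measurableI => //; exact: mbel.
  have mN2 : measurable N2 by apply: (mphi t0); apply: measurableI => //; exact: mbel.
  apply: measure_negligible => //; apply: negligibleU.
    by exists N1; split=> //; exact: density_zero_negligible.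
  by exists N2; split=> //; exact: projection_neg_negligible.
rewrite (ge0_negligible_integral _ _ _ _ QN)//; last 2 first.
- by apply: (mphi t0); apply: measurableI => //; exact: mbel.
- exact: measurable_funTS.
congr (integral _ _ _); rewrite N12; apply/seteqP; split=> w /=.
  move=> [[Bw bw] n]; split=> //; split=> //; apply: contrapT => ng; exact: n.
by move=> [[Bw gw] bw]; split=> // -[].
Qed.

Lemma integral_after_default B : check_G0_ext F t B ->
  (\int[Q]_(w in phi tau @^-1` (B `&` bel)) f (phi tau w) =
   \int[Q]_(w in phi tau @^-1` (B `&` bel)) V (phi tau w))%E.
Proof.
move=> cB; have sY s := check_G0_ext_sigma F s.
(* The sign of [f] is known on [D] only, whereas [integral_density] asks for it everywhere. *)
pose f1 := f \_ D.
have mD : measurable (D : set (Y b)).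
  apply: cG0_measurable; rewrite /check_G0_ext /= setIid -[D]setIT.
  exact: (YE (@measurableT _ (Y b))).
have mf : measurable_fun (setT : set (Y b)) f by exact/measurable_check_G0P.
have mf1 : measurable_fun (setT : set (Y b)) f1.
  by apply/(measurable_restrictT _ mD); exact: measurable_funTS.
have f10 x : (0 <= f1 x)%E by rewrite /f1 patchE; case: ifPn => // /set_mem /hf0.
have f1E x : D x -> f1 x = f x by move=> Dx; rewrite /f1 patchE mem_set.
pose B1 := B `&` regular_set.
have cB1 : check_G0_ext F t B1.
  by apply: YE; apply: measurableI => //; exact: cG0_measurable.
have mfphi : measurable_fun setT (f \o phi tau).
  exact: (measurableT_comp mf (measurable_phi hF htau htau0 b0)).
have mVphi : measurable_fun setT (V \o phi tau).
  exact: (measurableT_comp measurable_after_default_value (measurable_phi hF htau htau0 t0)).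
rewrite integral_regular_set//; last by move=> w; exact: hf0.
rewrite [RHS]integral_regular_set//; last by move=> w; exact: after_default_value_ge0.
pose one x : R := \1_(B1 `&` bel) x.
have mone s : t <= s -> measurable_fun (setT : set (Y s)) one.
  move=> ts; apply: measurable_indic; apply: cG0_measurable; apply: (check_G0_le ts).
  by apply: YE; apply: measurableI; [exact: cG0_measurable|exact: mbel].
have one0 x : 0 <= one x by rewrite /one indicE; case: (_ \in _).
(* For [t <= s] the factor [below s] is redundant on [bel]; it is inserted to match
   [integral_density], at [s = b] for [f] and at [s = t] for [V]. *)
have toone (k : Om * \bar R -> \bar R) s : t <= s ->
    (\int[Q]_(w in phi tau @^-1` (B1 `&` bel)) k (phi tau w) =
     \int[Q]_w ((one (phi tau w))%:E * k (phi tau w) * (\1_(below s) (phi tau w))%:E))%E.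
  move=> ts; rewrite integral_mkcond; apply: eq_integral => w _.
  rewrite patchE /one !indicE; case: ifPn => wB.
    have [? bw] : (B1 `&` bel) (phi tau w) by move: wB; rewrite inE.
    rewrite [in RHS]mem_set// mul1e mem_set ?mule1//.
    by rewrite /below /=; apply: (le_trans bw); rewrite lee_fin.
  by rewrite [in RHS]memNset ?mul0e// => wB'; move/negP: wB; apply; rewrite inE.
rewrite (toone f b tb) (toone V t (lexx t)).
under eq_integral do rewrite -(f1E _ (Dphi _)).
rewrite (@integral_density _ _ _ _ _ hF _ htau htau0 _ pA A0 _ _ _ _ hp b
  (fun x => (one x)%:E * f1 x)%E b0 bT); last 2 first.
- by apply: emeasurable_funM => //; apply/measurable_EFinP; exact: mone.
- by move=> x; rewrite mule_ge0// lee_fin.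
rewrite (@integral_density _ _ _ _ _ hF _ htau htau0 _ pA A0 _ _ _ _ hp t
  (fun x => (one x)%:E * V x)%E t0 tT); last 2 first.
- apply: emeasurable_funM; first by apply/measurable_EFinP; exact: mone.
  exact: measurable_after_default_value.
- by move=> x; rewrite mule_ge0 ?lee_fin// after_default_value_ge0.
have H0 x : D x -> (0 <= f x * (p b x)%:E)%E.
  by move=> Dx; rewrite mule_ge0 ?hf0// lee_fin (density_ge0 hp).
have mH : measurable_fun setT ((fun x => f x * (p b x)%:E)%E \o Psi : Om * RR -> \bar R).
  apply: emeasurable_funM; first exact: (measurableT_comp mf (measurable_Psi hF pA b0)).
  apply/measurable_EFinP.
  have mpb : measurable_fun (setT : set (Y b)) (p b).
    by apply/measurable_check_G0P; exact: (density_adapted hp b0 bT).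
  exact: (measurableT_comp mpb (measurable_Psi hF pA b0)).
have gB1 x : B1 x -> (0 <= g x)%E by move=> [_ []].
have bel_sub x s : t <= s -> (B1 `&` bel) x -> below s x.
  by move=> ts [_ xt]; apply: (le_trans xt); rewrite lee_fin.
transitivity (\int[QL]_x ((positive_level x * one (Psi x))%:E *
   (f (Psi x) * (p b (Psi x))%:E)))%E.
  apply: eq_integral => x _; rewrite f1E// /cox_weight /one !indicE.
  case: (boolP (Psi x \in B1 `&` bel)) => xB; last by rewrite mulr0 !mul0e.
  rewrite mem_set; last by apply: (bel_sub _ _ tb); exact: set_mem.
  by rewrite mul1r mul1e mulr1 EFinM muleCA.
rewrite (integral_projection hF pA hofp t0 H0 mH cB1 gB1).
apply: eq_integral => x _; rewrite /cox_weight /one !indicE.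
case: (boolP (Psi x \in B1 `&` bel)) => xB; last by rewrite mulr0 !mul0e.
rewrite mem_set; last by apply: (bel_sub _ _ (lexx t)); exact: set_mem.
(* Here [p t] is positive, so multiplying the quotient [V] by the density at time t gives back the
   projection. *)
have [[_ [p0 g0]] _] := set_mem xB.
rewrite mul1r mul1e mulr1 /V p0 g0 /= -muleA -EFinM mulrCA mulVf ?gt_eqF// mulr1.
by rewrite muleC.
Qed.

End after_default.
(** * The conditional expectation on {t < tau} *)

Section before_default.
Context d (Om : measurableType d) (R : realType) (Q : probability Om R).
Context (F : R -> set (set Om)) (hF : filtration Q F).
Context (tau : Om -> \bar R) (htau : measurable_fun setT tau).
Context (t : R) (t0 : 0 <= t).
Local Notation aft := [set w | (t%:E < tau w)%E].
Context (Zt : Om -> R) (hZ : cond_exp Q (F t) (fun w => (\1_aft w)%:E) (EFin \o Zt)).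
Context (X : Om -> \bar R) (mX : measurable_fun setT X) (X0 : forall w, (0 <= X w)%E).
Context (EF : Om -> \bar R)
  (hEF : cond_exp Q (F t) (fun w => X w * (\1_aft w)%:E)%E EF).
Local Notation Y := (g_sigma_algebraType (F t)).

Let sF : sigma_algebra setT (F t). Proof. exact: filtration_sigma_algebra hF _ t0. Qed.

Let YE B : measurable (B : set Y) -> F t B.
Proof. by rewrite measurable_g_measurableTypeE. Qed.

Let EY B : F t B -> measurable (B : set Y).
Proof. by rewrite measurable_g_measurableTypeE. Qed.

Let FM B : F t B -> measurable B. Proof. exact: (filtration_measurable hF t0). Qed.

Let mZ : measurable_fun (setT : set Y) Zt.
Proof.
case: hZ => /(measurable_wrtP sF) mZ _.
by apply/measurable_EFinP.
Qed.

Let mEF : measurable_fun (setT : set Y) EF.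
Proof. by case: hEF => /(measurable_wrtP sF). Qed.

Let toOm d' (S : sigmaRingType d') (h : Om -> S) :
  measurable_fun (setT : set Y) h -> measurable_fun setT h.
Proof. by move=> mh _ V mV; apply/FM/YE; exact: mh. Qed.

Let maft : measurable aft.
Proof.
have := @emeasurable_fun_o_infty _ _ _ setT _ measurableT htau t%:E.
by rewrite setTI.
Qed.

Let FZneg : F t [set w | Zt w < 0].
Proof.
apply: YE; rewrite (_ : [set _ | _] = Zt @^-1` `]-oo, 0[%classic).
  by rewrite -[X in measurable X]setTI; apply: mZ => //; exact: measurable_itv.
by apply/seteqP; split=> x /=; rewrite in_itv.
Qed.

Let FZle0 : F t [set w | Zt w <= 0].
Proof.
apply: YE; rewrite (_ : [set _ | _] = Zt @^-1` `]-oo, 0]%classic).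
  by rewrite -[X in measurable X]setTI; apply: mZ => //; exact: measurable_itv.
by apply/seteqP; split=> x /=; rewrite in_itv.
Qed.

Let FEFneg : F t [set w | (EF w < 0)%E].
Proof.
apply: YE; have := @emeasurable_fun_infty_o _ _ _ setT _ measurableT mEF 0%E.
by rewrite setTI.
Qed.

Let one_aft_ge0 w : (0 <= (\1_aft w)%:E :> \bar R)%E.
Proof. by rewrite lee_fin indicE; case: (_ \in _). Qed.

Lemma azema_neg_negligible : Q [set w | Zt w < 0] = 0%E.
Proof.
apply: (@measure0_integral_neg _ _ _ _ _ (EFin \o Zt)).
- exact: FM.
- by apply/measurable_EFinP/measurable_funTS; exact: toOm.
- by move=> w /=; rewrite lte_fin.
- by rewrite (hZ.2 _ FZneg); apply: integral_ge0 => w _; exact: one_aft_ge0.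
Qed.

(** {Z_t <= 0} belongs to [F t], so the probability in question is the integral of Z_t over that
    set, which is at most 0. *)
Lemma azema_zero_negligible : Q ([set w | Zt w <= 0] `&` aft) = 0%E.
Proof.
rewrite setIC -integral_indic//; last exact: FM.
apply/eqP; rewrite eq_le; apply/andP; split; last first.
  by apply: integral_ge0 => w _; exact: one_aft_ge0.
rewrite -(hZ.2 _ FZle0).
have -> : (\int[Q]_(w in [set w | (Zt w <= 0)%R]) (EFin \o Zt) w =
    - \int[Q]_(w in [set w | (Zt w <= 0)%R]) (- (EFin \o Zt) w))%E.
  rewrite -integral_ge0N//; last by move=> w /= Zw; rewrite lee_fin oppr_ge0.
  by under [RHS]eq_integral do rewrite oppeK.
by rewrite oppe_le0; apply: integral_ge0 => w /= Zw; rewrite lee_fin oppr_ge0.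
Qed.

Lemma cond_exp_neg_negligible : Q [set w | (EF w < 0)%E] = 0%E.
Proof.
apply: (@measure0_integral_neg _ _ _ _ _ EF) => //.
- exact: FM.
- by apply: measurable_funTS; exact: toOm.
- by rewrite (hEF.2 _ FEFneg); apply: integral_ge0 => w _; rewrite mule_ge0.
Qed.

Lemma ae_azema_gt0 : {ae Q, forall w, (t%:E < tau w)%E -> 0 < Zt w}.
Proof.
exists ([set w | Zt w <= 0] `&` aft); split.
- by apply: measurableI => //; exact: FM.
- exact: azema_zero_negligible.
- by move=> w /= /not_implyP[aw /negP]; rewrite -leNgt.
Qed.

Lemma ae_cond_exp_ge0 : {ae Q, forall w, (0 <= EF w)%E}.
Proof.
exists [set w | (EF w < 0)%E]; split.
- exact: FM.
- exact: cond_exp_neg_negligible.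
- by move=> w /= /negP; rewrite -ltNge.
Qed.

Definition before_default_value (w : Om) : \bar R :=
  if (0 < Zt w) && (0 <= EF w)%E then (EF w * ((Zt w)^-1)%:E)%E else 0%E.

Local Notation W := before_default_value.

Let good : set Om := [set w | 0 < Zt w /\ (0 <= EF w)%E].

Let Fgood : F t good.
Proof.
have -> : good = ~` ([set w | Zt w <= 0] `|` [set w | (EF w < 0)%E]).
  apply/seteqP; split=> w /=; first by move=> [Zw Ew] []; [rewrite leNgt Zw|rewrite ltNge Ew].
  move=> n; split; first by rewrite ltNge; apply/negP => Zw; apply: n; left.
  by rewrite leNgt; apply/negP => Ew; apply: n; right.
by apply: YE; apply: measurableC; apply: measurableU; exact: EY.
Qed.

Lemma before_default_value_ge0 w : (0 <= W w)%E.
Proof.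
rewrite /W; case: ifPn => // /andP[p0 g0].
by rewrite mule_ge0// lee_fin invr_ge0 ltW.
Qed.

Lemma measurable_before_default_value : measurable_fun (setT : set Y) W.
Proof.
rewrite (_ : W = (fun w => EF w * ((Zt w)^-1)%:E)%E \_ good); last first.
  apply/funext => x; rewrite /W patchE; case: ifPn => [/andP[? ?]|n].
    by rewrite mem_set.
  by rewrite memNset// => -[? ?]; move/negP: n; apply; apply/andP.
apply/(measurable_restrictT _ (EY Fgood)).
apply: emeasurable_funM; first exact: measurable_funTS.
apply/measurable_EFinP/measurable_funTS.
exact: (measurableT_comp (@measurable_inv R) mZ).
Qed.

(** The transfer lemma with identity maps onto [Om] equipped with [F t], where the weights [\1_aft]
    and Z_t define the same measure; the maximum with 0 supplies the sign that a version of Z_t may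
    lack. *)
Lemma integral_azema (k : Om -> \bar R) :
  measurable_fun (setT : set Y) k -> (forall w, 0 <= k w)%E ->
  (\int[Q]_w (k w * (\1_aft w)%:E) = \int[Q]_w (k w * (Num.max (Zt w) 0)%:E))%E.
Proof.
move=> mk k0; have mid : measurable_fun setT (idfun : Om -> Y).
  by move=> _ B mB; rewrite setTI; apply: FM; exact: (YE mB).
apply: (@ge0_integral_transfer _ _ _ Om Om Y R Q Q idfun idfun (\1_aft)
  (fun w => Num.max (Zt w) 0)) => //.
- by apply: measurable_maxr => //; exact: toOm.
- by move=> w; rewrite le_max lexx orbT.
move=> B mB; have FB := YE mB; rewrite !preimage_id -(hZ.2 _ FB).
apply: ae_eq_integral; first exact: FM.
- by apply/measurable_EFinP/measurable_funTS; exact: toOm.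
- by apply/measurable_EFinP/measurable_funTS/measurable_maxr => //; exact: toOm.
exists [set w | Zt w < 0]; split; [exact: FM|exact: azema_neg_negligible|].
move=> w /= n; rewrite ltNge; apply/negP => Zw; apply: n => _ /=.
by congr EFin; apply/esym/max_idPl.
Qed.

(** On {t < tau} the set [B] may be replaced by some [C] in [F t]. Conditioning then turns [\1_aft]
    into Z_t, which cancels the denominator of [W] and leaves [EF], whose defining property returns
    [X]. *)
Lemma integral_before_default B : G0_filtration F tau t B ->
  (\int[Q]_(w in B `&` aft) X w = \int[Q]_(w in B `&` aft) W w)%E.
Proof.
move=> GB; have [C FC CB] := G0_trace hF t0 GB.
have BC : B `&` aft = C `&` aft.
  by apply/seteqP; split=> w [? aw]; split=> //; apply/CB.
rewrite BC; apply/esym.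
have mC : measurable (C : set Y) by exact: EY.
transitivity (\int[Q]_w ((W \_ C) w * (\1_aft w)%:E))%E.
  rewrite integral_mkcond; apply: eq_integral => w _; rewrite !patchE indicE in_setI.
  case: (w \in C) => /=; last by rewrite mul0e.
  by case: (w \in aft); rewrite ?mule1 ?mule0.
rewrite integral_azema//; last 2 first.
- apply/(measurable_restrictT _ mC); apply: measurable_funTS.
  exact: measurable_before_default_value.
- by move=> w; rewrite patchE; case: ifP => // _; exact: before_default_value_ge0.
transitivity (\int[Q]_(w in C `&` good) EF w)%E.
  rewrite [RHS]integral_mkcond; apply: eq_integral => w _; rewrite !patchE in_setI.
  case: (w \in C) => /=; last by rewrite mul0e.
  rewrite /W; case: (boolP (w \in good)) => [|ng].
    rewrite inE => -[Zw Ew]; rewrite Zw Ew /= -muleA -EFinM.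
    by rewrite (max_idPl (ltW Zw)) mulVf ?gt_eqF// mule1.
  rewrite ifF ?mul0e//; apply/negP => /andP[Zw Ew].
  by move/negP: ng; apply; rewrite inE.
have FCg : F t (C `&` good) by exact: (sigma_algebra_setI sF (@subsetT _ _)).
rewrite (hEF.2 _ FCg).
(* Within [aft], [N] is exactly the complement of [good], so removing it from the domain restores
   the guards of [W] at no cost. *)
pose N := [set w | Zt w <= 0] `&` aft `|` [set w | (EF w < 0)%E].
have mN1 : measurable ([set w | Zt w <= 0] `&` aft) by apply: measurableI => //; exact: FM.
have mN2 : measurable [set w | (EF w < 0)%E] by exact: FM.
have mN : measurable N by exact: measurableU.
have QN : Q N = 0%E.
  apply: measure_negligible => //; apply: negligibleU.
    by eexists; split; [exact: mN1|exact: azema_zero_negligible|].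
  by eexists; split; [exact: mN2|exact: cond_exp_neg_negligible|].
rewrite [RHS](ge0_negligible_integral _ _ _ _ QN)//; last 2 first.
- by apply: measurableI => //; exact: FM.
- exact: measurable_funTS.
rewrite [LHS]integral_mkcond [RHS]integral_mkcond; apply: eq_integral => w _.
rewrite !patchE indicE.
have [aw|naw] := boolP (w \in aft); last first.
  rewrite mule0 if_same memNset// => -[[_ aw] _].
  by move/negP: naw; apply; rewrite inE.
rewrite mule1; congr (if _ then _ else _); move/set_mem in aw.
apply/idP/idP; rewrite !inE.
  move=> [Cw [Zw Ew]]; split=> // -[[/=]|/=]; first by rewrite leNgt Zw.
  by rewrite ltNge Ew.
move=> [[Cw _] nN]; split=> //; split; first by rewrite ltNge; apply/negP => Zw; apply: nN; left.
by rewrite leNgt; apply/negP => Ew; apply: nN; right.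
Qed.

End before_default.

(** * Assembly of the two terms *)

Lemma ge0_integral_ae_eq_set d (X : measurableType d) (R : realType)
    (m : {measure set X -> \bar R}) (B C : set X) (f : X -> \bar R) :
  measurable B -> measurable C -> measurable_fun setT f ->
  (forall x, 0 <= f x)%E -> {ae m, forall x, B x <-> C x} ->
  (\int[m]_(x in B) f x = \int[m]_(x in C) f x)%E.
Proof.
move=> mB mC mf f0 BC; rewrite integral_mkcond [RHS]integral_mkcond.
have mr E : measurable E -> measurable_fun setT (f \_ E).
  by move=> mE; apply/(measurable_restrictT _ mE); exact: measurable_funTS.
have r0 E x : (0 <= (f \_ E) x)%E by rewrite patchE; case: ifP.
apply: ge0_ae_eq_integral => //; [exact: mr..|].
apply: filterS BC => x [BC CB] _; rewrite !patchE; congr (if _ then _ else _).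
by apply/idP/idP; rewrite !inE.
Qed.

Unset Implicit Arguments.

Theorem theorem7p7 (d : measure_display) (Om : measurableType d) (R : realType)
    (Q : probability Om R)
    (F : R -> set (set Om)) (hF : filtration Q F)
    (tau : Om -> \bar R) (htau : measurable_fun setT tau)
    (htau0 : forall w, (0 <= tau w)%E)
    (Z M : R -> Om -> R) (A : Om -> cumulative R R)
    (hZ : azema_supermartingale Q F tau Z)
    (hZMA : canonical_decomposition Q F Z M A)
    (hA1 : forall w (t : R), 0 <= t -> A w t < 1)
    (T : \bar R) (hT : (0 <= T)%E)
    (iM : \bar R -> R -> Om -> R) (hiM : iM_family Q F tau iM)
    (hdiff : iM_differentiable Q F iM A T)
    (p : R -> Om * \bar R -> R) (hp : regularized_density Q F tau Z A iM T p)
    (b : R) (hb0 : 0 <= b) (hbT : (b%:E < T)%E)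
    (f : Om * \bar R -> \bar R)
    (hf : measurable_wrt (@prod_domain d Om R) (check_G0 F b) f)
    (hf0 : forall x, prod_domain x -> (0 <= f x)%E)
    (t : R) (ht0 : 0 <= t) (htb : t <= b)
    (* ofp : the parametrized optional projection of f p_{b+};
       EF, EG : versions of E[f(phi) 1_{t < tau} | F_t] and E[f(phi) | G_t] *)
    (ofp : R -> Om * \bar R -> \bar R)
    (hofp : param_optional_projection Q F (fun x => f x * (p b x)%:E)%E ofp)
    (EF : Om -> \bar R)
    (hEF : cond_exp Q (F t)
       (fun w => f (phi tau w) * (\1_[set w' | (t%:E < tau w')%E] w)%:E)%E EF)
    (EG : Om -> \bar R)
    (hEG : cond_exp Q (G_filtration Q F tau t) (f \o phi tau) EG) :
  {ae Q, forall w,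
    EG w =
    (EF w * ((Z t w)^-1)%:E * (\1_[set w' | (t%:E < tau w')%E] w)%:E
     + ofp t (phi tau w) * ((p t (phi tau w))^-1)%:E
       * (\1_[set w' | 0 < p t (phi tau w')] w)%:E
       * (\1_[set w' | (tau w' <= t%:E)%E] w)%:E)%E}.
Proof.
case: hZMA => _ pA A0 _.
have tT : (t%:E < T)%E by apply: le_lt_trans hbT; rewrite lee_fin.
have mphi s : 0 <= s -> measurable_fun setT
    (phi tau : Om -> g_sigma_algebraType (check_G0_ext F s)).
  by move=> s0; exact: (measurable_phi hF htau htau0 s0).
pose X := f \o phi tau.
have mX : measurable_fun setT X.
  have /measurable_check_G0P mf := hf.
  exact: (measurableT_comp mf (mphi b hb0)).
have X0 w : (0 <= X w)%E by apply: hf0; exact: htau0.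
pose aft := [set w | (t%:E < tau w)%E].
have maft : measurable aft.
  have := @emeasurable_fun_o_infty _ _ _ setT _ measurableT htau t%:E.
  by rewrite setTI.
have hZt := hZ.2 t ht0.
pose W := before_default_value (Z t) EF.
pose V := after_default_value p t ofp.
have W0 w : (0 <= W w)%E by exact: before_default_value_ge0.
have V0 x : (0 <= V x)%E by exact: after_default_value_ge0.
(* The guarded candidate: non-negative everywhere and measurable for G^0_t without completion. *)
pose Y w := if (t%:E < tau w)%E then W w else V (phi tau w).
have Y0 w : (0 <= Y w)%E by rewrite /Y; case: ifP.
have sG0 := G0_filtration_sigma F tau t.
have mW := measurable_before_default_value hF ht0 hZt hEF.
have mV := measurable_after_default_value hF hp ht0 htb hbT hofp.
have mYG0 : measurable_wrt setT (G0_filtration F tau t) Y.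
  apply/(measurable_wrtP sG0).
  apply: measurable_fun_ifT.
  - apply: (measurable_fun_bool true).
    rewrite setTI measurable_g_measurableTypeE//.
    exact: (phi_check_G0 htau0 (@check_G0_lt _ _ _ F t)).
  - move=> _ S mS; rewrite measurable_g_measurableTypeE//.
    apply: (F_sub_G0 hF ht0).
    have := mW measurableT S mS; rewrite measurable_g_measurableTypeE//.
    exact: filtration_sigma_algebra hF _ ht0.
  - move=> _ S mS; rewrite measurable_g_measurableTypeE//.
    have := mV measurableT S mS.
    rewrite measurable_g_measurableTypeE; last exact: check_G0_ext_sigma.
    move=> /(phi_check_G0 htau0); rewrite !setTI; exact.
have G0M := G0_sub_measurable hF htau ht0.
have GM := G_sub_measurable hF htau ht0.
have mY : measurable_fun setT Y.
  by move=> _ S mS; apply: G0M; apply: mYG0; exists S.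
have IY B : G0_filtration F tau t B ->
    (\int[Q]_(w in B) Y w = \int[Q]_(w in B) X w)%E.
  move=> GB; have mB := G0M _ GB.
  have BE : B = (B `&` aft) `|` (B `&` ~` aft) by rewrite -setIUr setUv setIT.
  have ma : measurable (B `&` aft) by exact: measurableI.
  have mb : measurable (B `&` ~` aft) by apply: measurableI => //; exact: measurableC.
  have dab : [disjoint B `&` aft & B `&` ~` aft].
    by apply/disj_set2P; rewrite setIACA setICr setI0.
  rewrite BE !ge0_integral_setU//; [|exact: measurable_funTS..].
  have [C cC CB] := G0_lift hF ht0 GB.
  have bE : B `&` ~` aft = phi tau @^-1` (C `&` below t).
    rewrite preimage_setI CB; congr (_ `&` _); apply/seteqP; split=> w /=.
      by move=> /negP; rewrite -leNgt.
    by move=> tw; apply/negP; rewrite -leNgt.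
  congr (_ + _)%E.
    rewrite (integral_before_default hF htau ht0 hZt mX X0 hEF GB).
    by apply: eq_integral => w; rewrite inE => -[_ aw]; rewrite /Y ifT.
  rewrite bE (integral_after_default hF htau htau0 pA A0 hp ht0 htb hbT hf hf0 hofp cC).
  apply: eq_integral => w; rewrite inE => -[_ bw].
  by rewrite /Y ifF//; apply/negbTE; rewrite -leNgt.
have sG := G_filtration_sigma Q F tau t.
have EGY : {ae Q, forall w, EG w = Y w}.
  apply: (ae_eq_of_integral_eq sG GM) => //.
  - by move=> S /mYG0; exact: G0_sub_G.
  - by case: hEG.
  - by move=> B GB; rewrite (hEG.2 _ GB); apply: integral_ge0 => w _; exact: X0.
  - move=> B GB; have [B0' GB0 BB0] := G_ae_G0 hF htau ht0 GB.
    have mB := GM _ GB; have mB0 := G0M _ GB0.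
    rewrite (hEG.2 _ GB) (ge0_integral_ae_eq_set mB mB0 mY Y0 BB0) (IY _ GB0).
    by apply/esym; exact: ge0_integral_ae_eq_set.
have gpos := ae_projection_ge0 hF htau htau0 pA A0 hp ht0 htb hbT hf0 hofp.
have Zpos := ae_azema_gt0 hF htau ht0 hZt.
have EF0 := ae_cond_exp_ge0 hF ht0 X0 hEF.
apply: filterS2 (filterI EGY EF0) (filterI Zpos gpos) => w [-> EFw] [Zw gw].
rewrite /Y !indicE; have [tw|tw] := ltP t%:E (tau w).
  rewrite /W /before_default_value (Zw tw) EFw /=.
  rewrite [w \in [set w' | (t%:E < tau w')%E]]mem_set//.
  rewrite [w \in [set w' | (tau w' <= t%:E)%E]]memNset; last by rewrite /= leNgt tw.
  by rewrite mule1 mule0 adde0.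
rewrite [w \in [set w' | (t%:E < tau w')%E]]memNset; last by rewrite /= ltNge tw.
rewrite [w \in [set w' | (tau w' <= t%:E)%E]]mem_set//.
have gE : projection_below ofp t (phi tau w) = ofp t (phi tau w).
  by rewrite /projection_below patchE mem_set.
rewrite mule0 add0e mule1 /V /after_default_value gE.
(* If [p t] is positive, the remaining guard of [V] holds almost surely by [gpos]; otherwise the
   guard and the indicator of the statement both give 0. *)
have [pw|pw] := boolP (0 < p t (phi tau w)).
  by rewrite -gE gw// gE [w \in _]mem_set//= mule1.
by rewrite [w \in _]memNset/= ?mule0//; exact/negP.
Qed.
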